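(* Let $G$ be a finite graph and let $n$ be a positive integer. Let $D_n(G)=(D_n^i(G),d^i)$ be the graded chain complex defined in the context. Then: (i) the homology groups of $D_n(G)$ are graph invariants; (ii) the graded Euler characteristic of $D_n(G)$ is equal to $Q_{G,n}(q)=P_G(q^n,1+q+q^2+\cdots+q^n)$.
   Context: Graphs are finite, loops and multiple edges being allowed. For a graph $G$ with vertex set $V(G)$ and edge set $E(G)$ and $s\subset E(G)$, let $[G:s]$ be the graph with vertex set $V(G)$ and edge set $s$, and let $k(s)$ be its number of connected components. The dichromatic polynomial $P_G(q,v)$ is determined by $P_G=P_{G-e}-qP_{G/e}$ for every edge $e$ (deletion and contraction), and $P_{N_k}=v^k$ for the graph $N_k$ with $k$ vertices and no edges; equivalently $P_G(q,v)=\sum_{s\subset E(G)}(-1)^{|s|}q^{|s|}v^{k(s)}$. Graded modules. For a $\mathbb{Z}$-graded $\mathbb{Z}$-module $M=\bigoplus_k M_k$, the graded dimension is $q\dim M=\sum_k q^k\,\mathrm{rank}(M_k)$ with $\mathrm{rank}(M_k)=\dim_{\mathbb{Q}}(M_k\otimes\mathbb{Q})$. The shift $M\{l\}$ is defined by $M\{l\}_k=M_{k-l}$ (all degrees are increased by $l$). The graded Euler characteristic of a graded chain complex with chain groups in positions $0\le i\le m$ is $\sum_{0\le i\le m}(-1)^i q\dim(H^i)$, where $H^i$ are the homology groups. The complex $D_n(G)$, $n\ge 1$. Let $V$ be the graded free $\mathbb{Z}$-module with basis $1=X^0,X,X^2,\dots,X^n$, where $X^i$ has degree $n-i$. Let $G$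 have $m$ edges, ordered $e_1,\dots,e_m$. For $\epsilon\in\{0,1\}^m$ let $G_\epsilon=[G:s_\epsilon]$ with $s_\epsilon=\{e_i:\epsilon_i=1\}$, let $|\epsilon|=\sum_i\epsilon_i$, and let $k(\epsilon)$ be the number of connected components of $G_\epsilon$. Put $V_\epsilon(G)=V^{\otimes k(\epsilon)}\{n|\epsilon|\}$, with one tensor factor $V$ for each connected component of $G_\epsilon$, and $D_n^i(G)=\bigoplus_{|\epsilon|=i}V_\epsilon(G)$. Per-edge maps: let $\epsilon$ have $\epsilon_j=0$ and let $\epsilon^+$ be obtained from $\epsilon$ by changing $\epsilon_j$ to $1$ (i.e. adding edge $e_j$). Let $\xi$ be the tuple obtained from $\epsilon$ by replacing $\epsilon_j$ by the symbol $\ast$. The map $d_\xi:V_\epsilon(G)\to V_{\epsilon^+}(G)$ is the identity on the tensor factors of components not touched by $e_j$, and on the remaining factors it is as follows. (1) If $e_j$ joins two distinct components of $G_\epsilon$, it is the map $V\otimes V\to V\{n\}$, $X^a\otimes X^b\mapsto X^{a+b}$ ($0\le a,b\le n$), where $X^c=0$ for $c>n$. (2) If both ends of $e_j$ lie in one component of $G_\epsilon$, it is the map $V\to V\{n\}$ with $1\mapsto X^n$ and $X^a\mapsto 0$ for $a=1,\dots,n$. The differential $d^i:D_n^i(G)\to D_n^{i+1}(G)$ is $d^i=\sum_{|\xi|=i}(-1)^\xi d_\xi$, the sum being over all $m$-tuples $\xi$ of $0$'s, $1$'s and exactly one $\ast$ with $|\xi|=i$, where $|\xi|$ is the number of $1$'s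 in $\xi$, and $(-1)^\xi$ is $-1$ if there is an odd number of $1$'s before $\ast$ in $\xi$ and $+1$ otherwise ($d_\xi$ is extended by zero to the other summands). The maps $d^i$ preserve degree and satisfy $d^{i+1}\circ d^i=0$. That the homology groups are graph invariants means that, up to isomorphism of graded $\mathbb{Z}$-modules, each of them depends only on the isomorphism class of $G$ (and $n$) and not on the chosen ordering of the edges. *)

(* Defs.v *)
(* MathComp, with the classical layer of MathComp-Analysis (boolp,
   classical_sets, fsbigop). *)
From HB Require Import structures.
From mathcomp Require Import all_boot all_order all_algebra.
From mathcomp Require Import boolp classical_sets fsbigop.

Set Implicit Arguments.
Unset Strict Implicit.
Unset Printing Implicit Defensive.

Import GRing.Theory.

Local Open Scope ring_scope.

(** * Graphs *)

(* Loops and multiple edges are allowed. Edges are undirected: the order of the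
   two components of [ends e] is immaterial, see [adj] and [graph_iso]. *)
Record graph := Graph {
  vertex : finType;
  edge : finType;
  ends : edge -> vertex * vertex }.

Definition adj (G : graph) (s : {set edge G}) : rel (vertex G) :=
  fun u v => [exists e in s, (ends e == (u, v)) || (ends e == (v, u))].

(* Connectedness in the spanning subgraph [G:s]. *)
Definition conn (G : graph) (s : {set edge G}) : rel (vertex G) :=
  connect (adj s).

Definition ncomp (G : graph) (s : {set edge G}) : nat :=
  n_comp (adj s) (vertex G).

Definition graph_iso (G H : graph) : Prop :=
  exists (phi : vertex G -> vertex H) (psi : edge G -> edge H),
    [/\ bijective phi, bijective psi &
        forall e, let: (u, v) := ends e in
          ends (psi e) = (phi u, phi v) \/ ends (psi e) = (phi v, phi u)].

(* An ordering of the edges is a duplicate-free list of all of them; the edge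
   [e] comes at position [index e o]. *)
Definition edge_ordering (G : graph) (o : seq (edge G)) : Prop :=
  perm_eq o (enum (edge G)).

(** * The dichromatic polynomial *)

(* P_G(q, v), in Z[q][v]: the outer variable is v and the inner one is q. *)
Definition dichromatic (G : graph) : {poly {poly int}} :=
  \sum_(s : {set edge G}) (-1) ^+ #|s| * ('X%:P) ^+ #|s| * 'X^(ncomp s).

(* The state sum above satisfies, and is hence determined by, the deletion-contraction
   recursion: see [dichromatic_delete_contract] and [dichromatic_edgeless]. *)

Lemma adjP (G : graph) (s : {set edge G}) u v :
  reflect (exists2 e, e \in s & ends e = (u, v) \/ ends e = (v, u)) (adj s u v).
Proof.
apply: (iffP existsP) => [[e /andP[es /orP[]/eqP]]|[e es [] E]].
- by exists e; last by left.
- by exists e; last by right.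
- by exists e; rewrite es E eqxx.
- by exists e; rewrite es E eqxx orbT.
Qed.

Lemma adj_sym (G : graph) (s : {set edge G}) : symmetric (adj s).
Proof.
by move=> u v; apply/adjP/adjP => -[e es [E|E]]; exists e => //; [right|left|right|left].
Qed.

Lemma conn_sym (G : graph) (s : {set edge G}) : connect_sym (adj s).
Proof. exact/sym_connect_sym/adj_sym. Qed.

Definition delete (G : graph) (e : edge G) : graph :=
  {| vertex := vertex G;
     edge := {f : edge G | f != e};
     ends := fun f => ends (val f) |}.

(* The vertices of [G/e] are the components of [G:{e}]. *)
Definition contract_vertex (G : graph) (e : edge G) : finType :=
  {v | v \in roots (adj [set e])}.

Definition contract_proj (G : graph) (e : edge G) (v : vertex G) :
    contract_vertex e :=
  exist _ (fingraph.root (adj [set e]) v) (roots_root (@conn_sym G _) v).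

Definition contract (G : graph) (e : edge G) : graph :=
  {| vertex := contract_vertex e;
     edge := {f : edge G | f != e};
     ends := fun f => (contract_proj e (ends (val f)).1,
                       contract_proj e (ends (val f)).2) |}.

Definition edgeless (T : finType) : graph :=
  {| vertex := T; edge := void; ends := fun e => match e with end |}.

Lemma ncomp_delete (G : graph) (e : edge G) (s : {set edge (delete e)}) :
  ncomp s = ncomp (G := G) [set val f | f in s].
Proof.
apply: eq_n_comp; apply: eq_connect => u v.
apply/adjP/adjP => [[f fs E]|[_ /imsetP[f fs ->] E]]; last by exists f.
by exists (val f); first exact: imset_f.
Qed.

Lemma ncomp_contract (G : graph) (e : edge G) (s : {set edge (contract e)}) :
  ncomp s = ncomp (G := G) (e |: [set val f | f in s]).
Proof.
pose t : {set edge G} := e |: [set val f | f in s].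
have proj_conn v : connect (adj t) v (val (contract_proj e v)).
  apply: connect_sub (connect_root (adj [set e]) v) => x y /adjP[f].
  move=> /set1P-> E; apply/connect1/adjP; exists e => //; exact: setU11.
have projE x y : connect (adj [set e]) x y -> contract_proj e x = contract_proj e y.
  by move=> /(fingraph.rootP (@conn_sym _ _)) E; apply: val_inj.
symmetry; apply: (adjunction_n_comp (val : contract_vertex e -> vertex G)
                    (@conn_sym G t) (@conn_sym (contract e) s)) => //.
apply: (intro_adjunction (@conn_sym (contract e) s) _
          (fun x _ => contract_proj e x)) => [//|x _|x' _].
- split=> [//|y _ /adjP[f /setU1P[->|/imsetP[g gs ->]] E]].
    apply: eq_connect0; apply: projE; apply/connect1/adjP.
    by exists e; first exact: set11.
  apply/connect1/adjP; exists g => //=.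
  by case: E => -> /=; [left | right].
- split=> [|y' /adjP[f fs E]].
    apply: eq_connect0; apply: val_inj => /=.
    by case: x' => x xr /=; apply/esym/eqP.
  set w := ends (val f); have c12 : connect (adj t) w.1 w.2.
    apply/connect1/adjP; exists (val f); last by left; rewrite -surjective_pairing.
    by rewrite setU1r // imset_f.
  have c: connect (adj t) (val (contract_proj e w.1)) (val (contract_proj e w.2)).
    apply: connect_trans (proj_conn w.2); apply: connect_trans c12.
    by rewrite conn_sym.
  by case: E => -[<- <-]; rewrite // conn_sym.
Qed.

Lemma dichromatic_delete_contract (G : graph) (e : edge G) :
  dichromatic G = dichromatic (delete e) - 'X%:P * dichromatic (contract e).
Proof.
pose im (t : {set {f : edge G | f != e}}) := [set val f | f in t].
have imI : injective im by apply: imset_inj; exact: val_inj.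
have cardim t : #|im t| = #|t| by rewrite card_imset //; exact: val_inj.
have eim t : e \notin im t by apply/imsetP => -[[f fe] _ /= E]; rewrite E eqxx in fe.
have imK (s : {set edge G}) : e \notin s -> im [set f | val f \in s] = s.
  move=> es; apply/setP=> f; apply/imsetP/idP => [[g]|fs]; first by rewrite inE => gs ->.
  have fe : f != e by apply: contraNneq es => <-.
  by exists (exist _ f fe); rewrite ?inE.
rewrite /dichromatic (bigID (fun s : {set edge G} => e \notin s)) /=; congr (_ + _).
  rewrite (reindex_onto im (fun s => [set f | val f \in s])) => [|s /imK //].
  apply: eq_big => [t|t _]; last by rewrite cardim ncomp_delete.
  by rewrite eim; apply/eqP; apply: imI; rewrite imK.
rewrite mulr_sumr -sumrN.
rewrite (reindex_onto (fun t => e |: im t)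
          (fun s => [set f | val f \in s :\ e])) => [|s].
  apply: eq_big => [t|t _].
    rewrite setU11 /=; apply/eqP/setP => f; rewrite !inE.
    case: f => f fe /=; rewrite fe (negPf fe) /=.
    apply/imsetP/idP => [[g gt E]|ft]; last by exists (exist _ f fe).
    by rewrite (_ : exist _ f fe = g) //; apply: val_inj.
  rewrite cardsU1 eim cardim ncomp_contract add1n !exprS mulN1r !mulNr mulrCA !mulrA.
  by [].
move=> /negbNE es; rewrite imK; first exact: finset.setD1K.
by rewrite finset.setD11.
Qed.

Lemma dichromatic_edgeless (T : finType) : dichromatic (edgeless T) = 'X^#|T|.
Proof.
rewrite /dichromatic (big_pred1 finset.set0) => [|s]; last first.
  by apply/esym/eqP/setP => -[].
rewrite cards0 !expr0 !mul1r; congr ('X^_).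
apply: eq_card => x; rewrite !inE andbT; apply/eqP.
have := connect_root (adj (G := edgeless T) finset.set0) x.
by move=> /connectP[[_ //|y p /=/andP[/adjP[[]]]]].
Qed.

(* Q_{G,n}(q) = P_G(q^n, 1 + q + ... + q^n). *)
Definition dichromatic_spec (n : nat) (G : graph) : {poly int} :=
  (map_poly (fun p : {poly int} => p \Po 'X^n) (dichromatic G)).[
    \sum_(j < n.+1) 'X^j].

(** * Graded Z-modules and their graded dimension *)

Definition gmodule := int -> zmodType.

Definition gmodule_iso (M N : gmodule) : Prop :=
  forall k, exists f : {additive M k -> N k}, bijective f.

Definition biadditive (A B C : zmodType) (t : A -> B -> C) : Prop :=
  (forall a a' b, t (a + a') b = t a b + t a' b) /\
  (forall a b b', t a (b + b') = t a b + t a b').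

(* (T, t) is the tensor product of the Z-modules A and B (universal property). *)
Definition is_tensor_product (A B T : zmodType) (t : A -> B -> T) : Prop :=
  biadditive t /\
  forall (C : zmodType) (f : A -> B -> C), biadditive f ->
    exists g : {additive T -> C},
      (forall a b, g (t a b) = f a b) /\
      (forall g' : {additive T -> C},
         (forall a b, g' (t a b) = f a b) -> g' =1 g).

(* rank A = dim_Q (A (x) Q), i.e., the r such that A (x) Q = Q^r; it is 0 by
   convention if A (x) Q is infinite-dimensional. An additive bijection between
   rational vector spaces is automatically Q-linear. *)
Definition rank (A : zmodType) : nat :=
  xget 0%N [set r | exists t : A -> rat -> 'rV[rat]_r, is_tensor_product t]%classic.

(* The Laurent polynomials in q are regarded as rational fractions in q. The sum
   is over all degrees; it is meant for graded modules with only finitely many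
   components of nonzero rank (it is 0 by convention for the others). *)
Definition qdim (M : gmodule) : {fraction {poly int}} :=
  \sum_(k \in [set: int]%classic) (rank (M k))%:R * (FracField.tofrac ('X : {poly int})) ^ k.

Definition graded_euler_char (m : nat) (H : nat -> gmodule) :
    {fraction {poly int}} :=
  \sum_(i < m.+1) (-1) ^+ i * qdim (H i).

(** * Homology of a graded complex *)

(* The terms C^0, C^1, ..., the degree k part [piece i k] of C^i, and the
   differentials C^i -> C^(i+1). That the differentials preserve degrees and
   compose to zero is not part of the structure. *)
Record graded_complex := GradedComplex {
  term : nat -> zmodType;
  piece : forall i, int -> zmodClosed (term i);
  cdiff : forall i, {additive term i -> term i.+1} }.

Section Homology.
Variables (C : graded_complex) (i : nat) (k : int).

Definition is_cocycle : {pred term C i} :=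
  [pred c | (c \in piece C i k) && (cdiff C i c == 0)].

Fact is_cocycle_zmod_closed : zmod_closed is_cocycle.
Proof.
split=> [|x y]; rewrite !inE ?rpred0 ?raddf0 ?eqxx //.
move=> /andP[px /eqP dx] /andP[py /eqP dy].
by rewrite rpredB //= raddfB dx dy subr0.
Qed.
HB.instance Definition _ := GRing.isZmodClosed.Build (term C i) is_cocycle
  is_cocycle_zmod_closed.

Record cocycle := Cocycle { cocycle_val : term C i; _ : cocycle_val \in is_cocycle }.
HB.instance Definition _ := [isSub for cocycle_val].
HB.instance Definition _ := [Choice of cocycle by <:].
HB.instance Definition _ := [SubChoice_isSubZmodule of cocycle by <:].

(* The complex is extended by 0 in negative positions. *)
Definition coboundary_prop : term C i -> Prop :=
  match i with
  | 0 => fun z => z = 0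
  | j.+1 => fun z => exists2 c, c \in piece C j k & cdiff C j c = z
  end.

Definition is_coboundary : {pred cocycle} :=
  fun z => `[< coboundary_prop (cocycle_val z) >].

Fact is_coboundary_zmod_closed : zmod_closed is_coboundary.
Proof.
have H : coboundary_prop 0 /\
    forall x y, coboundary_prop x -> coboundary_prop y -> coboundary_prop (x - y).
  rewrite /coboundary_prop; case: i => [|j].
    by split=> // x y -> ->; rewrite subr0.
  split=> [|x y [a pa <-] [b pb <-]]; first by exists 0; rewrite ?rpred0 ?raddf0.
  by exists (a - b); rewrite ?rpredB ?raddfB.
split=> [|x y]; first exact/asboolP/H.1.
by move=> /asboolP hx /asboolP hy; apply/asboolP/H.2.
Qed.
HB.instance Definition _ := GRing.isZmodClosed.Build cocycle is_coboundary
  is_coboundary_zmod_closed.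

Definition homology_piece : zmodType := Quotient.quot is_coboundary.

End Homology.

Definition homology (C : graded_complex) (i : nat) : gmodule :=
  fun k => homology_piece C i k.

(** * The complex D_n(G) *)

Section Complex.
Variables (n : nat) (G : graph) (o : seq (edge G)).

(* V_epsilon, for s = s_epsilon, is the free Z-module on the monomials
   X^(a_1) (x) ... (x) X^(a_k(s)), one exponent a_j in {0, ..., n} for each
   component of [G:s]. Such a monomial is encoded as the function which maps
   each vertex to the exponent at its component. Hence the following type is a
   basis of D_n^i(G). *)
Definition is_state (i : nat) (x : {set edge G} * {ffun vertex G -> 'I_n.+1}) :=
  (#|x.1| == i) &&
  [forall u, forall v, conn x.1 u v ==> (x.2 u == x.2 v)].

Definition state (i : nat) := {x | is_state i x}.

Definition state_set i (x : state i) : {set edge G} := (val x).1.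
Definition exponent i (x : state i) : vertex G -> nat := fun v => (val x).2 v.

(* X^a has degree n - a; the summand n * |epsilon| is the shift {n|epsilon|}. *)
Definition degree i (x : state i) : int :=
  (\sum_(v in roots (adj (state_set x))) (n - exponent x v)
   + n * #|state_set x|)%N%:Z.

Definition chain (i : nat) : zmodType := {ffun state i -> int}.

Definition homogeneous i (k : int) : {pred chain i} :=
  [pred c : {ffun state i -> int} | [forall x, (c x != 0) ==> (degree x == k)]].

Fact homogeneous_zmod_closed i k : zmod_closed (@homogeneous i k).
Proof.
split=> [|a b].
  by rewrite inE; apply/forallP=> x; rewrite ffunE eqxx.
rewrite !inE => /forallP ha /forallP hb; apply/forallP=> x.
rewrite !ffunE; apply/implyP; apply: contraR => nk.
move: (ha x) (hb x); rewrite !implybE (negPf nk) !orbF !negbK.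
by move=> /eqP-> /eqP->; rewrite subr0.
Qed.
HB.instance Definition _ i k := GRing.isZmodClosed.Build (chain i)
  (@homogeneous i k) (@homogeneous_zmod_closed i k).

(* The coefficient, 0 or 1, of the monomial y in d_xi(x), where xi is obtained
   from epsilon by putting * in place of e. As y is constant on the component of
   G_(epsilon^+) containing e, it is enough to give its exponent at u. In the
   second case the product vanishes when the sum of the exponents exceeds n, as
   the exponent of y is at most n. *)
Definition edge_map i (e : edge G) (x : state i) (y : state i.+1) : bool :=
  let: (u, v) := ends e in
  let s := state_set x in
  [&& e \notin s, state_set y == e |: s,
      [forall w, ~~ conn s u w && ~~ conn s v w
                 ==> (exponent y w == exponent x w)] &
      if conn s u v then (exponent x u == 0%N) && (exponent y u == n)
      else exponent y u == (exponent x u + exponent x v)%N].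

(* (-1)^xi: the elements of s before e are the 1's before *. *)
Definition edge_sign (s : {set edge G}) (e : edge G) : int :=
  (-1) ^+ #|[set f in s | (index f o < index e o)%N]|.

Definition differential i (c : {ffun state i -> int}) :
    {ffun state i.+1 -> int} :=
  [ffun y => \sum_(x : state i) \sum_(e | edge_map e x y)
               edge_sign (state_set x) e * c x].

Fact differential_zmod_morphism i : zmod_morphism (@differential i).
Proof.
move=> a b; apply/ffunP=> y; rewrite !ffunE -sumrB; apply: eq_bigr => x _.
by rewrite -sumrB; apply: eq_bigr => e _; rewrite !ffunE mulrBr.
Qed.
HB.instance Definition _ i := GRing.isZmodMorphism.Build (chain i) (chain i.+1)
  (@differential i) (@differential_zmod_morphism i).

Definition dichromatic_complex : graded_complex :=
  {| term := chain;
     piece := fun i k => @homogeneous i k;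
     cdiff := fun i => @differential i |}.

End Complex.

(* Main.v *)
Require Import Defs.
From HB Require Import structures.
From mathcomp Require Import all_boot all_order all_algebra.
From mathcomp Require boolp classical_sets fsbigop.
From mathcomp Require Import zify ring.

Set Implicit Arguments.
Unset Strict Implicit.
Unset Printing Implicit Defensive.

Import Order.TTheory GRing.Theory Num.Theory.

Local Open Scope ring_scope.

(** Invariance. An isomorphism of graphs matches the monomials of the two
    complexes, compatibly with degrees and with the unsigned per-edge maps
    ([edge_map_transport]). To match the signs as well, the monomials over an edge
    set [s] are multiplied by the sign of the permutation of [s] which passes from
    one ordering of the edges to the other: adding an edge [e] to [s] multiplies
    this sign by the quotient of the two signs attached to [e] in the differentials
    ([reordering_sign_setU1]). The result is an isomorphism of complexes, hence of
    homology ([graph_iso_homology]). A change of ordering is the case of the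
    identity isomorphism.

    Euler characteristic. The graded Euler characteristic can be computed on chains
    instead of homology, provided that the differential preserves degrees and has
    square zero. Both are easiest to see when a monomial is described by the
    degrees [b = n - a] of its tensor factors [X^a] rather than by the exponents:
    merging two components and closing a cycle then become one rule, namely to add
    the [b] of all the components that are joined and to subtract [n] at the
    component of the new edge, with result zero if a negative degree would appear
    ([edge_mapE]). Summing over the components, the degree drops by [n], which the
    shift compensates ([edge_map_degree]). Applying the rule to two edges gives a
    formula which is symmetric in them ([edge_map2P]), while the signs are
    antisymmetric, so the terms of the squared differential cancel in pairs
    ([differential_square0]).

    The rank of an abelian group is defined through its tensor product with [Q].
    For a subquotient [ker D2 / im D1] of [Z^N] it is [N - rk D1 - rk D2], with the
    ranks of the matrices taken over [Q] ([rank_subquotient]). In the alternating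
    sum over the positions the ranks of the differentials cancel, and the signed
    count of the monomials by degree is left ([euler_char_states]). For a fixed edge
    set [s] the exponents at the components of [[G:s]] are independent, so this
    count is a product with one factor [1 + q + ... + q^n] for each component
    ([sum_comp_const]), which is the state sum of the dichromatic polynomial. *)

(** * Ranks of abelian groups *)

Lemma additiveZ_rat r s (g : {additive 'rV[rat]_r -> 'rV[rat]_s}) c v :
  g (c *: v) = c *: g v.
Proof.
have gZint (z : int) w : g (z%:~R *: w) = z%:~R *: g w.
  by rewrite !scaler_int raddfMz.
have dc : (denq c)%:~R != 0 :> rat by rewrite intr_eq0 denq_neq0.
apply: (can_inj (scalerK dc)); rewrite -gZint !scalerA.
have -> : (denq c)%:~R * c = (numq c)%:~R by rewrite mulrC -numqE.
exact: gZint.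
Qed.

(** An additive map between rational vector spaces is linear, so it is given by a
    matrix. *)
Lemma additive_rat_dim_le r s (g : {additive 'rV[rat]_r -> 'rV[rat]_s}) :
  injective g -> (r <= s)%N.
Proof.
move=> ginj; pose M : 'M[rat]_(r, s) := \matrix_i g (delta_mx 0 i).
have gE v : g v = v *m M.
  rewrite mulmx_sum_row {1}[v]row_sum_delta raddf_sum.
  by apply: eq_bigr => i _; rewrite additiveZ_rat rowK.
suff : row_free M by move=> /eqP <-; exact: rank_leq_col.
by apply: inj_row_free => v; rewrite -gE -(raddf0 g) => /ginj.
Qed.

(** The universal property yields mutually inverse additive maps between two
    tensor products, so the dimension in the definition of the rank is unique. *)
Lemma rank_tensor (A : zmodType) r (t : A -> rat -> 'rV[rat]_r) :
  is_tensor_product t -> rank A = r.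
Proof.
move=> tP; rewrite /rank; case: classical_sets.xgetP => [s -> [t' t'P]|/(_ r)[]].
  have le r1 r2 (t1 : A -> rat -> 'rV[rat]_r1) (t2 : A -> rat -> 'rV[rat]_r2) :
      is_tensor_product t1 -> is_tensor_product t2 -> (r1 <= r2)%N.
    move=> [b1 u1] [b2 u2].
    have [g [gE _]] := u1 _ _ b2; have [h [hE _]] := u2 _ _ b1.
    have [i [iE iu]] := u1 _ _ b1.
    apply: (@additive_rat_dim_le _ _ g); apply: (can_inj (g := h)) => v.
    transitivity (i v); last by rewrite -(iu idfun).
    by rewrite -(iu (h \o g : {additive _ -> _})) // => a b; rewrite /= gE hE.
  by apply/eqP; rewrite eqn_leq (le _ _ _ _ tP t'P) (le _ _ _ _ t'P tP).
by exists t.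
Qed.

Lemma clear_denominators N (v : 'rV[rat]_N) :
  exists m (u : 'rV[int]_N), (0 < m)%N /\ v *+ m = map_mx intr u.
Proof.
pose den i := absz (denq (v 0 i)).
exists (\prod_i den i)%N, (\row_i (numq (v 0 i) *+ (\prod_(j | j != i) den j)%N)).
split; first by apply: prodn_gt0 => i; rewrite absz_gt0 denq_neq0.
apply/rowP => i; rewrite -scaler_nat !mxE (bigD1 i) //= raddfMn /=.
rewrite natrM mulrAC mulr_natr; congr (_ *+ _).
by rewrite pmulrn gez0_abs ?denq_ge0 // mulrC -numqE.
Qed.

Lemma biadditive_additive (A B C : zmodType) (f : A -> B -> C) :
  biadditive f ->
  (forall b, zmod_morphism (f^~ b)) /\ (forall a, zmod_morphism (f a)).
Proof.
move=> [fl fr]; split=> [b x y|a x y]; apply/eqP.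
  by rewrite eq_sym subr_eq -fl subrK.
by rewrite eq_sym subr_eq -fr subrK.
Qed.

(** A map from [A] to [Q^r] with torsion kernel whose image spans [Q^r] becomes
    an isomorphism after tensoring with [Q]: modulo torsion, a suitable multiple
    of any element of [A] is an integral combination of elements of [A] mapped to
    a basis, and this determines the values of a biadditive map. *)
Lemma rank_spanning (A : zmodType) r (phi : {additive A -> 'rV[rat]_r})
    (a : 'I_r -> A) :
  (forall x, phi x = 0 -> exists2 l, (0 < l)%N & x *+ l = 0) ->
  \matrix_i phi (a i) \in unitmx -> rank A = r.
Proof.
set P := \matrix_i _ => torsion Punit.
apply: (@rank_tensor A r (fun x q => q *: phi x)); split.
  by split=> [x y b|x b c]; rewrite ?raddfD ?scalerDr ?scalerDl.
move=> C f /biadditive_additive[fl fr].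
pose fL q : {additive A -> C} :=
  HB.pack (f^~ q) (GRing.isZmodMorphism.Build A C (f^~ q) (fl q)).
pose fR x : {additive rat -> C} :=
  HB.pack (f x) (GRing.isZmodMorphism.Build rat C (f x) (fr x)).
have fMn x q k : f (x *+ k) q = f x (q *+ k).
  exact: etrans (raddfMn (fL q) k x) (esym (raddfMn (fR x) k q)).
have fsum q (x : 'I_r -> A) : f (\sum_j x j) q = \sum_j f (x j) q.
  exact: (raddf_sum (fL q)).
have fMz x q z : f (x *~ z) q = f x (q *~ z).
  exact: etrans (raddfMz (fL q) z x) (esym (raddfMz (fR x) z q)).
pose g0 (w : 'rV[rat]_r) : C := \sum_j f (a j) ((w *m invmx P) 0 j).
have g0P : zmod_morphism g0.
  move=> v w; rewrite /g0 -sumrB; apply: eq_bigr => j _.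
  by rewrite mulmxBl !mxE fr.
pose g : {additive _ -> _} := HB.pack g0 (GRing.isZmodMorphism.Build _ _ g0 g0P).
have gE x q : g (q *: phi x) = f x q.
  rewrite /g /= /g0 -scalemxAl; set c := phi x *m invmx P.
  have [m [u [m0 uE]]] := clear_denominators c.
  (* A multiple [m * l] of [x] is an integral combination of the [a j]; moving
     the factor [m * l] between the two arguments of [f] expresses [f x q] through
     the values [f (a j) _]. *)
  have /torsion[l l0] : phi (x *+ m - \sum_j a j *~ u 0 j) = 0.
    rewrite raddfB raddf_sum raddfMn -[phi x](mulmxKV Punit) -/c.
    apply/eqP; rewrite subr_eq0 -scaler_nat scalemxAl scaler_nat uE.
    rewrite mulmx_sum_row; apply/eqP/eq_bigr => j _.
    by rewrite raddfMz mxE rowK scaler_int.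
  move=> /eqP; rewrite mulrnBl subr_eq0 -mulrnA => /eqP xE.
  have ml0 : (m * l)%:R != 0 :> rat by rewrite pnatr_eq0 -lt0n muln_gt0 m0.
  pose q' := q / (m * l)%:R.
  have qE : q = q' *+ (m * l) by rewrite -mulr_natr divfK.
  rewrite {2}qE -fMn xE -sumrMnl fsum; apply: eq_bigr => j _.
  rewrite fMn fMz.
  congr (f (a j) _); rewrite mxE {1}qE.
  have -> : c 0 j = (u 0 j)%:~R / m%:R.
    have := congr1 (fun M : 'rV[rat]_r => M 0 j) uE; rewrite -scaler_nat !mxE => <-.
    by rewrite mulrAC mulfV ?mul1r // pnatr_eq0 -lt0n.
  rewrite -mulr_natr natrM -mulrzr -mulr_natr.
  by field; rewrite pnatr_eq0 -lt0n.
exists g; split=> // g' g'E w; have wE := mulmxKV Punit w.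
rewrite -wE mulmx_sum_row !raddf_sum; apply: eq_bigr => j _.
by rewrite rowK g'E gE.
Qed.

(** If [H] is the subquotient [ker D2 / im D1] of [Z^N], then [H] tensored with
    [Q] is the corresponding subquotient of [Q^N]: the class of a cycle is sent
    to its image in [Q^N / im D1], the latter embedded in [Q^N] by [cokermx]. *)
Lemma rank_subquotient (H : zmodType) p N q
    (D1 : 'M[int]_(p, N)) (D2 : 'M[int]_(N, q)) (cl : 'rV[int]_N -> H) :
  let rk k l (M : 'M[int]_(k, l)) := \rank (map_mx intr M : 'M[rat]_(k, l)) in
  D1 *m D2 = 0 ->
  (forall u v, u *m D2 = 0 -> v *m D2 = 0 -> cl (u - v) = cl u - cl v) ->
  (forall h, exists2 u, u *m D2 = 0 & cl u = h) ->
  (forall u, u *m D2 = 0 -> cl u = 0 <-> exists w, u = w *m D1) ->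
  (rank H + rk _ _ D1 + rk _ _ D2 = N)%N.
Proof.
move=> rk D12 clB cl_surj cl0.
have cl_0 : cl 0 = 0 by rewrite -[X in cl X](subr0 0) clB ?mul0mx // subrr.
have clMn u m : u *m D2 = 0 -> cl (u *+ m) = cl u *+ m.
  move=> u0; elim: m => [//|m IH].
  have um0 : (u *+ m) *m D2 = 0 by rewrite -scaler_nat -scalemxAl u0 scaler0.
  have clN : cl (- u) = - cl u by rewrite -[- u]sub0r clB ?mul0mx // cl_0 sub0r.
  rewrite !mulrSr -[X in cl (_ + X)]opprK.
  by rewrite clB ?mulNmx ?u0 ?oppr0 // IH clN opprK.
pose qm k l (M : 'M[int]_(k, l)) : 'M[rat]_(k, l) := map_mx intr M.
have qm_inj k l : injective (@qm k l).
  by move=> M M' /matrixP E; apply/matrixP => i j; have := E i j; rewrite !mxE => /intr_inj.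
have qmM k l o (M : 'M_(k, l)) (M' : 'M_(l, o)) : qm _ _ (M *m M') = qm _ _ M *m qm _ _ M'.
  exact: map_mxM.
pose Q1 := qm _ _ D1; pose Q2 := qm _ _ D2; pose K := kermx Q2.
have Q12 : Q1 *m Q2 = 0 by rewrite -qmM D12 [qm _ _ _]map_mx0.
(* The row space of [W] is a copy of the quotient of the rational kernel of [D2]
   by the rational image of [D1], and [B] is a basis of it. *)
pose W := K *m cokermx Q1; pose r := \rank W; pose B := row_base W.
have Bfree : row_free B by exact: row_base_free.
have rE : (r + \rank Q1 + \rank Q2 = N)%N.
  have := mxrank_mul_ker K (cokermx Q1); rewrite -/r.
  have -> : \rank (K :&: kermx (cokermx Q1))%MS = \rank Q1.
    apply/eqmx_rank/andP; split.
      apply: submx_trans (capmxSr _ _) _.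
      by rewrite submxE mulmx_ker.
    by rewrite sub_capmx; apply/andP; split; apply/sub_kermxP; rewrite ?Q12 ?mulmx_coker.
  by rewrite /K mxrank_ker; have := rank_leq_row Q2; lia.
have inW (u : 'rV_N) : u *m D2 = 0 -> (qm _ _ u *m cokermx Q1 <= B)%MS.
  move=> u0; rewrite eq_row_base submxMr //; apply/sub_kermxP.
  by rewrite -qmM u0 [qm _ _ _]map_mx0.
pose coord (u : 'rV_N) := qm _ _ u *m cokermx Q1 *m pinvmx B.
have coordB u v : coord (u - v) = coord u - coord v.
  by rewrite /coord /qm map_mxB !mulmxBl.
have coord0 u : u *m D2 = 0 -> coord u = 0 -> (qm _ _ u <= Q1)%MS.
  by move=> /inW/mulmxKpV uE u0; rewrite submxE -uE -/(coord u) u0 mul0mx.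
have coord_cl u : u *m D2 = 0 -> cl u = 0 -> coord u = 0.
  move=> u0 /(cl0 _ u0)[w ->]; rewrite /coord qmM -/Q1.
  by rewrite -(mulmxA _ Q1) mulmx_coker mulmx0 mul0mx.
pose rep h := sval (boolp.cid2 (cl_surj h)).
have repP h : rep h *m D2 = 0 /\ cl (rep h) = h by rewrite /rep; case: boolp.cid2.
pose phi0 h := coord (rep h).
have phiE u : u *m D2 = 0 -> phi0 (cl u) = coord u.
  move=> u0; have [r0 rcl] := repP (cl u); apply/eqP.
  rewrite -subr_eq0 -coordB; apply/eqP/coord_cl; first by rewrite mulmxBl r0 u0 subrr.
  by rewrite clB // rcl subrr.
have phi0P : zmod_morphism phi0.
  move=> h h'; have [[r0 rcl] [r0' rcl']] := (repP h, repP h').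
  rewrite -{1}rcl -{1}rcl' -clB // phiE ?coordB //.
  by rewrite mulmxBl r0 r0' subrr.
pose phi : {additive H -> 'rV[rat]_r} :=
  HB.pack phi0 (GRing.isZmodMorphism.Build _ _ phi0 phi0P).
have torsion h : phi h = 0 -> exists2 l, (0 < l)%N & h *+ l = 0.
  have [r0 rcl] := repP h => /(coord0 _ r0)/submxP[w wE].
  have [m [u [m0 uE]]] := clear_denominators w; exists m => //.
  rewrite -rcl -clMn //; apply/cl0.
    by rewrite -scaler_nat -scalemxAl r0 scaler0.
  have quE : qm _ _ u = w *+ m := esym uE.
  exists u; apply: qm_inj; rewrite qmM quE.
  rewrite -[in RHS]scaler_nat -scalemxAl -wE.
  by apply/rowP => j; rewrite -scaler_nat !mxE rmorphM rmorph_nat.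
(* Every vector of the basis [B] has a multiple which comes from an integral
   cycle. *)
have lift (b : 'I_r) : exists m u, [/\ (0 < m)%N, u *m D2 = 0 & coord u = delta_mx 0 b *+ m].
  have /submxP[w wE] : (row b B <= W)%MS.
    by apply: submx_trans (row_sub _ _) _; rewrite eq_row_base.
  have [m [u [m0 uE]]] := clear_denominators (w *m K); exists m, u.
  have quE : qm _ _ u = m%:R *: (w *m K) by rewrite scaler_nat uE.
  split=> //.
    apply: qm_inj; rewrite qmM quE -scalemxAl -mulmxA mulmx_ker mulmx0 scaler0.
    by rewrite [qm _ _ _]map_mx0.
  rewrite /coord quE -!scalemxAl -(mulmxA w K) -/W -wE -scaler_nat.
  by rewrite rowE -mulmxA mulmxVp ?mulmx1.
have [m mP] := boolp.choice lift; have [a aP] := boolp.choice mP.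
suff rH : rank H = r by rewrite rH; exact: rE.
apply: (@rank_spanning H r phi (fun b => cl (a b)) torsion).
have -> : \matrix_b phi (cl (a b)) = diag_mx (\row_b (m b)%:R).
  apply/row_matrixP => b; rewrite rowK /= phiE; last by case: (aP b).
  have [_ _ ->] := aP b; apply/rowP => j; rewrite -scaler_nat !mxE eqxx /=.
  by rewrite eq_sym mulr_natr.
rewrite unitmxE det_diag unitfE prodf_seq_neq0; apply/allP => b _ /=.
by rewrite mxE pnatr_eq0 -lt0n; case: (aP b).
Qed.

(** * Components of spanning subgraphs *)

Lemma conn_sub (G : graph) (s t : {set edge G}) u v :
  s \subset t -> conn s u v -> conn t u v.
Proof.
move=> /subsetP st; apply: connect_sub => x y /adjP[e /st et E].
by apply/connect1/adjP; exists e.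
Qed.

Lemma conn_setU1 (G : graph) (s : {set edge G}) e u v w w' :
  ends e = (u, v) ->
  conn (e |: s) w w' =
    [|| conn s w w', conn s w u && conn s v w' | conn s w v && conn s u w'].
Proof.
move=> E; have sub := conn_sub (subsetUr [set e] s).
have uv : conn (e |: s) u v.
  by apply/connect1/adjP; exists e; [exact: setU11|left].
have vu : conn (e |: s) v u by rewrite /conn conn_sym.
apply/idP/or3P => [|[/sub//|/andP[a b]|/andP[a b]]]; last 2 first.
- exact: connect_trans (sub _ _ a) (connect_trans uv (sub _ _ b)).
- exact: connect_trans (sub _ _ a) (connect_trans vu (sub _ _ b)).
move=> /connectP[p]; elim: p w => [|x p IH] w /=.
  by move=> _ ->; constructor 1; exact: connect0.
move=> /andP[/adjP[f /setU1P[->|fs] fE] /IH{}IH /IH{IH}]; last first.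
  have wx : conn s w x by apply/connect1/adjP; exists f.
  case=> [xw'|/andP[xu vw']|/andP[xv uw']].
  - by constructor 1; exact: connect_trans xw'.
  - by constructor 2; rewrite vw' andbT; exact: connect_trans xu.
  - by constructor 3; rewrite uw' andbT; exact: connect_trans xv.
case: fE; rewrite E => -[<- <-].
- case=> [vw'|/andP[vu' vw']|/andP[_ uw']].
  + by constructor 2; rewrite vw' /conn connect0.
  + by constructor 2; rewrite vw' /conn connect0.
  + by constructor 1.
- case=> [uw'|/andP[_ vw']|/andP[_ uw']].
  + by constructor 3; rewrite uw' /conn connect0.
  + by constructor 1.
  + by constructor 3; rewrite uw' /conn connect0.
Qed.

Lemma rootK (G : graph) (s : {set edge G}) u :
  fingraph.root (adj s) (fingraph.root (adj s) u) = fingraph.root (adj s) u.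
Proof. exact: (root_root (@conn_sym G s)). Qed.

Lemma rootE (G : graph) (s : {set edge G}) u v :
  (fingraph.root (adj s) u == fingraph.root (adj s) v) = conn s u v.
Proof. exact: (root_connect (@conn_sym G s)). Qed.

Lemma conn_root (G : graph) (s : {set edge G}) v : conn s v (fingraph.root (adj s) v).
Proof. exact: connect_root. Qed.

Lemma in_roots (G : graph) (s : {set edge G}) r :
  (r \in roots (adj s)) = (fingraph.root (adj s) r == r).
Proof. by []. Qed.

(** Meant for [F] constant on the components of [[G:s]]: each of the components
    contained in the component of [w] in [[G:t]] counts once, through its
    representative. *)
Definition comp_sum (G : graph) (s t : {set edge G}) (F : vertex G -> nat) w : nat :=
  \sum_(r in roots (adj s) | conn t r w) F r.

Definition comp_const (G : graph) (s : {set edge G}) (F : vertex G -> nat) :=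
  forall u v, conn s u v -> F u = F v.

Lemma comp_sum_const (G : graph) (s t : {set edge G}) F : comp_const t (comp_sum s t F).
Proof.
move=> u v uv; apply: eq_bigl => r; congr (_ && _).
by rewrite /conn !(conn_sym t r) (same_connect (@conn_sym G t) uv).
Qed.

Lemma comp_sum1 (G : graph) (s t : {set edge G}) F w :
  comp_const s F -> (forall z, conn t z w -> conn s z w) -> s \subset t ->
  comp_sum s t F w = F w.
Proof.
move=> FP tw st; rewrite /comp_sum (big_pred1 (fingraph.root (adj s) w)).
  by apply/esym/FP/conn_root.
move=> r /=; rewrite in_roots; apply/andP/eqP => [[/eqP rr /tw rw]|->].
  by rewrite -rr; apply/eqP; rewrite rootE.
by rewrite rootK eqxx; split=> //; apply: conn_sub st _; rewrite /conn conn_sym connect_root.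
Qed.

Lemma comp_sum2 (G : graph) (s t : {set edge G}) F u v w :
  comp_const s F -> ~~ conn s u v ->
  (forall z, conn t z w = conn s z u || conn s z v) ->
  comp_sum s t F w = (F u + F v)%N.
Proof.
move=> FP nuv tw; rewrite /comp_sum.
pose ru := fingraph.root (adj s) u; pose rv := fingraph.root (adj s) v.
have nr : rv != ru by rewrite eq_sym rootE.
rewrite (bigD1 ru) /=; last first.
  by rewrite in_roots rootK eqxx /= tw /conn conn_sym connect_root.
rewrite (bigD1 rv) /=; last first.
  rewrite in_roots rootK eqxx nr andbT /=.
  by rewrite tw /conn [X in _ || X]conn_sym connect_root orbT.
rewrite big1 ?addn0 => [|r].
  by rewrite -(FP _ _ (conn_root s u)) -(FP _ _ (conn_root s v)).
rewrite in_roots tw -!rootE => /andP[/andP[/andP[/eqP -> ]]].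
by rewrite -/ru -/rv; case/orP => ->; rewrite ?andbF.
Qed.

Lemma comp_sum_trans (G : graph) (s t t' : {set edge G}) F w :
  t \subset t' ->
  comp_sum t t' (comp_sum s t F) w = comp_sum s t' F w.
Proof.
move=> tt'; rewrite /comp_sum (exchange_big_dep (fun r => (r \in roots (adj s)) && conn t' r w)) /=.
  apply: eq_bigr => r /andP[rs rw].
  rewrite (big_pred1 (fingraph.root (adj t) r)) // => r' /=.
  rewrite rs /= in_roots; apply/andP/eqP => [[/andP[/eqP r'r' _] rr']|->].
    by rewrite -r'r'; apply/eqP; rewrite rootE /conn conn_sym.
  rewrite rootK eqxx /= conn_root; split=> //; apply: connect_trans rw; apply: conn_sub tt' _.
  by rewrite /conn conn_sym connect_root.
move=> r r' /andP[_ rw] /andP[-> rr'] /=.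
by apply: connect_trans rw; exact: conn_sub rr'.
Qed.

(** Exactly one component of [[G:t]] contains [u]. *)
Lemma comp_sum_ind (G : graph) (t t' : {set edge G}) n u w :
  t \subset t' -> comp_sum t t' (fun r => n * conn t u r)%N w = (n * conn t' u w)%N.
Proof.
move=> tt'; rewrite /comp_sum -big_distrr /=; congr (n * _)%N.
pose ru := fingraph.root (adj t) u.
have uru : conn t' u ru by apply: conn_sub tt' (conn_root t u).
have [uw|nuw] := boolP (conn t' u w); last first.
  rewrite big1 // => r /andP[_ rw]; apply/eqP; rewrite eqb0; apply: contra nuw => ur.
  by apply: connect_trans rw; apply: conn_sub ur.
rewrite (bigD1 ru) /=; last first.
  rewrite in_roots rootK eqxx /=; apply: connect_trans uw.
  by rewrite /conn conn_sym.
rewrite conn_root big1 // => r; rewrite in_roots => /andP[/andP[/eqP rr _] nr].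
by apply/eqP; rewrite eqb0 -rootE rr eq_sym.
Qed.

(** A new edge joins at most two components: this connects the sums over components
    with the two cases in the definition of the per-edge maps. *)
Lemma comp_sum_setU1 (G : graph) (s : {set edge G}) e u v w F :
  ends e = (u, v) -> comp_const s F ->
  comp_sum s (e |: s) F w =
    if conn s u w || conn s v w then
      if conn s u v then F u else (F u + F v)%N
    else F w.
Proof.
move=> E FP; have sub := subsetUr [set e] s.
have symm x y : conn s x y = conn s y x by exact: conn_sym.
have conn_e z w' : conn (e |: s) z w' =
    [|| conn s z w', conn s z u && conn s v w' | conn s z v && conn s u w'].
  exact: conn_setU1.
case: ifP => [uvw|/norP[/negPf nu /negPf nv]]; last first.
  by apply: comp_sum1 => // z; rewrite conn_e nu nv !andbF !orbF.
case: ifP => [uv|/negbT nuv].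
  have uw : conn s u w by case/orP: uvw => // vw; exact: connect_trans vw.
  rewrite (FP _ _ uw); apply: comp_sum1 => // z; rewrite conn_e.
  case/or3P=> // /andP[zx _].
    exact: connect_trans zx uw.
  by apply: connect_trans zx (connect_trans _ uw); rewrite -/(conn s v u) symm.
apply: comp_sum2 => // z; rewrite conn_e.
apply/idP/idP => [/or3P[zw|/andP[-> //]|/andP[-> _]]|]; last 2 first.
- by rewrite orbT.
- move=> h; case/orP: uvw h => [uw|vw] /orP[zu|zv].
  + by rewrite (_ : conn s z w) //; exact: connect_trans zu uw.
  + by rewrite uw zv !orbT.
  + by rewrite vw zu orbT.
  + by rewrite (_ : conn s z w) //; exact: connect_trans zv vw.
case/orP: uvw => [uw|vw].
  by rewrite (_ : conn s z u) //; apply: connect_trans zw _; rewrite -/(conn s w u) symm.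
by rewrite orbC (_ : conn s z v) //; apply: connect_trans zw _; rewrite -/(conn s w v) symm.
Qed.

Lemma conn_setU1_end (G : graph) (s : {set edge G}) e u v w :
  ends e = (u, v) -> conn (e |: s) u w = conn s u w || conn s v w.
Proof.
move=> E; rewrite (conn_setU1 _ _ _ E); rewrite {2}/conn connect0 /=.
by case: (conn s u w); rewrite //= ?andbF ?orbF.
Qed.

(** * The per-edge maps in terms of degrees *)

Section States.
Variables (n : nat) (G : graph).

Lemma exponent_le i (x : state n G i) w : (exponent x w <= n)%N.
Proof. by rewrite /exponent -ltnS. Qed.

Lemma exponent_const i (x : state n G i) : comp_const (state_set x) (exponent x).
Proof.
move=> u v uv; case/andP: (valP x) => _ /forallP/(_ u)/forallP/(_ v)/implyP.
by move=> /(_ uv)/eqP; rewrite /exponent => ->.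
Qed.

Lemma card_state_set i (x : state n G i) : #|state_set x| = i.
Proof. by case/andP: (valP x) => /eqP. Qed.

Definition factor_degree i (x : state n G i) (w : vertex G) : nat := n - exponent x w.

Lemma factor_degree_le i (x : state n G i) w : (factor_degree x w <= n)%N.
Proof. exact: leq_subr. Qed.

Lemma factor_degree_const i (x : state n G i) : comp_const (state_set x) (factor_degree x).
Proof. by move=> u v /exponent_const uv; rewrite /factor_degree uv. Qed.

Lemma state_factor_degree_inj i (x y : state n G i) :
  state_set x = state_set y -> factor_degree x =1 factor_degree y -> x = y.
Proof.
move=> sE dE; apply/val_inj; rewrite [val x]surjective_pairing [val y]surjective_pairing.
congr (_, _); first exact: sE.
apply/ffunP => w; apply/val_inj; have := dE w.
have := exponent_le x w; have := exponent_le y w; rewrite /factor_degree /exponent /=; lia.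
Qed.

Lemma exists_state (s : {set edge G}) (F : vertex G -> nat) i :
  #|s| = i -> comp_const s F -> (forall w, F w <= n)%N ->
  exists2 x : state n G i, state_set x = s & factor_degree x =1 F.
Proof.
move=> si FP Fn; pose a := [ffun w => inord (n - F w) : 'I_n.+1].
have xP : is_state i (s, a).
  rewrite /is_state /= si eqxx /=; apply/forallP => u; apply/forallP => v.
  by apply/implyP => /FP uv; rewrite !ffunE uv.
exists (exist _ (s, a) xP) => // w; have := Fn w.
by rewrite /factor_degree /exponent /= ffunE inordK ?ltnS ?leq_subr //; exact: subKn.
Qed.

(** With [X^a] described by its degree [b = n - a], the product of [X^a] and
    [X^a'] has [n - (a + a') = b + b' - n], and the map sending [1] to [X^n] and the
    other powers to [0] has [b - n] wherever this is not negative. So both cases of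
    the per-edge map add up the degrees of the components that are joined, two or
    one, and subtract [n] at the component of the new edge. *)
Lemma edge_mapE i e (x : state n G i) (y : state n G i.+1) :
  let s := state_set x in
  edge_map e x y =
    [&& e \notin s, state_set y == e |: s &
        [forall w, factor_degree y w + n * conn (e |: s) (ends e).1 w ==
                   comp_sum s (e |: s) (factor_degree x) w]%N].
Proof.
move=> s; rewrite /edge_map; case E: (ends e) => [u v] /=; rewrite -/s.
case: (e \notin s) => //=; case: eqP => //= ys.
have xP w := exponent_le x w; have yP w := exponent_le y w.
have yu w : conn s u w || conn s v w -> exponent y w = exponent y u.
  by rewrite -(conn_setU1_end _ _ E) -ys => /exponent_const.
have sumE w := comp_sum_setU1 w E (@factor_degree_const _ x).
apply/andP/forallP => [[/forallP h1 h2] w|h].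
  rewrite (conn_setU1_end _ _ E) [comp_sum _ _ _ _]sumE -/s; case: ifP => uvw.
    rewrite /factor_degree yu //; have := xP u; have := xP v; have := yP u.
    by case: ifP h2 => _; [move=> /andP[/eqP h3 /eqP h4]|move=> /eqP h3]; lia.
  have /implyP := h1 w; rewrite -negb_or uvw => /(_ isT)/eqP.
  by rewrite /factor_degree => ->; rewrite muln0 addn0.
split.
  apply/forallP => w; apply/implyP; rewrite -negb_or => nuvw.
  have := h w; rewrite (conn_setU1_end _ _ E) [comp_sum _ _ _ _]sumE -/s (negPf nuvw).
  by have := xP w; have := yP w; rewrite /factor_degree; lia.
have := h u; rewrite (conn_setU1_end _ _ E) [comp_sum _ _ _ _]sumE -/s.
have -> : conn s u u by exact: connect0.
have := xP u; have := xP v; have := yP u; rewrite /factor_degree /=.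
by case: (conn s u v); lia.
Qed.

Lemma edge_map_inj i e (x : state n G i) (y y' : state n G i.+1) :
  edge_map e x y -> edge_map e x y' -> y = y'.
Proof.
rewrite !edge_mapE => /and3P[_ /eqP ys /forallP yP] /and3P[_ /eqP y's /forallP y'P].
apply: state_factor_degree_inj => [|w]; first by rewrite ys.
by have := yP w; have := y'P w; lia.
Qed.

Lemma degreeE i (x : state n G i) :
  degree x = (\sum_(v in roots (adj (state_set x))) factor_degree x v + n * i)%N%:Z.
Proof. by rewrite /degree card_state_set. Qed.

(** The subtraction of [n] at one component is compensated by the shift, as the
    edge set gains one element. *)
Lemma edge_map_degree i e (x : state n G i) (y : state n G i.+1) :
  edge_map e x y -> degree x = degree y.
Proof.
rewrite edge_mapE; set s := state_set x; set t := e |: s; set u := (ends e).1.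
move=> /and3P[_ /eqP ys /forallP yP]; rewrite !degreeE ys -/s -/t; congr Posz.
have st : s \subset t by exact: subsetUr.
have -> : (\sum_(v in roots (adj s)) factor_degree x v =
           \sum_(w in roots (adj t)) comp_sum s t (factor_degree x) w)%N.
  rewrite /comp_sum (exchange_big_dep (mem (roots (adj s)))) /=; last by move=> ? ? _ /andP[].
  apply: eq_bigr => r; rewrite in_roots => rr.
  rewrite (big_pred1 (fingraph.root (adj t) r)) // => w /=.
  rewrite !in_roots rr /=.
  rewrite -rootE; apply/andP/eqP => [[/eqP <- /eqP ->]|->]; first by rewrite rootK.
  by rewrite rootK eqxx.
rewrite -(eq_bigr _ (fun w _ => eqP (yP w))) big_split /= -big_distrr /=.
have -> : (\sum_(w in roots (adj t)) conn t u w = 1)%N.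
  rewrite (bigD1 (fingraph.root (adj t) u)) /=; last by rewrite in_roots rootK.
  rewrite conn_root big1 // => w /andP[]; rewrite in_roots => /eqP wr nr.
  by apply/eqP; rewrite eqb0 -rootE wr eq_sym.
lia.
Qed.

End States.

(** * The differential squares to zero *)

Section SquareZero.
Variables (n : nat) (G : graph) (o : seq (edge G)).
Hypothesis o_ordering : edge_ordering o.

(** The composite of two per-edge maps is given by a formula which is symmetric in
    the two edges. The point is that the intermediate monomial exists as soon as the
    final one does, that is, that its degrees lie between [0] and [n]. *)
Lemma edge_map2P i e f (x : state n G i) (z : state n G i.+2) :
  let s := state_set x in let t := f |: (e |: s) in
  reflect (exists2 y : state n G i.+1, edge_map e x y & edge_map f y z)
    [&& e \notin s, f \notin s, e != f, state_set z == t &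
        [forall w, factor_degree z w + n * conn t (ends e).1 w + n * conn t (ends f).1 w
                   == comp_sum s t (factor_degree x) w]%N].
Proof.
move=> s t; set s1 := e |: s.
have s1t : s1 \subset t by exact: subsetUr.
apply: (iffP and5P) => [[es fs ef /eqP zt /forallP zP]|[y]]; last first.
  rewrite !edge_mapE => /and3P[es /eqP ys /forallP yP].
  rewrite ys in_setU1 negb_or => /and3P[/andP[fe fs] /eqP zt /forallP zP].
  split=> //; first by rewrite eq_sym.
    exact/eqP.
  apply/forallP => w; have /eqP zw := zP w.
  rewrite -(comp_sum_trans _ _ _ s1t) -/s1.
  rewrite [X in _ == X](_ : _ = \sum_(r in roots (adj s1) | conn t r w)
      (factor_degree y r + n * conn s1 (ends e).1 r))%N; last first.
    by apply: eq_bigr => r _; rewrite (eqP (yP r)).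
  rewrite big_split /= -/(comp_sum _ _ _ _) -zw -/t.
  by rewrite -/(comp_sum s1 t (fun r => n * conn s1 (ends e).1 r)%N w) comp_sum_ind // addnAC.
(* The first edge must find degree at least [n] on its component [D] in
   [[G:s1]]. Unless the second edge joins [D] to another component, the formula
   for [z] gives this at once. If it joins [D] to [D'], the degrees on [D] and [D']
   add up to at least [2 * n], and the one on [D'] is at most [n] since [D'] is also
   a component of [[G:s]]. *)
set u := (ends e).1 in zP *; set u' := (ends f).1 in zP *.
have E : ends e = (u, (ends e).2) by exact: surjective_pairing.
have F : ends f = (u', (ends f).2) by exact: surjective_pairing.
set v := (ends e).2 in E; set v' := (ends f).2 in F.
have xP := @factor_degree_const _ _ _ x; have xn := factor_degree_le x.
pose b := comp_sum s s1 (factor_degree x).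
have b_const : comp_const s1 b by exact: comp_sum_const.
have bE w : b w = if conn s u w || conn s v w then
    if conn s u v then factor_degree x u else (factor_degree x u + factor_degree x v)%N
  else factor_degree x w by exact: (comp_sum_setU1 w E xP).
have b_far w : ~~ conn s1 u w -> (b w <= n)%N.
  rewrite (conn_setU1_end _ _ E) => /negPf nuw.
  by rewrite bE nuw.
have b_near w : (b w <= n + n * conn s1 u w)%N.
  rewrite (conn_setU1_end _ _ E) bE; have := xn u; have := xn v; have := xn w.
  by case: (_ || _); case: (conn s u v) => /=; lia.
have b_ge w : (n * conn s1 u w <= b w)%N.
  have [uw|_] := boolP (conn s1 u w); last by rewrite muln0.
  have := eqP (zP w); rewrite (conn_sub s1t uw) -(comp_sum_trans _ _ _ s1t) -/b.
  rewrite (comp_sum_setU1 _ F b_const) (conn_setU1_end _ _ F).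
  case: ifP => [uvw'|_]; last by lia.
  have near a a' : conn s1 a w -> ~~ conn s1 a a' -> (b a' <= n)%N.
    move=> aw naa'; apply: b_far; apply: contra naa' => ua'.
    apply: connect_trans aw (connect_trans _ ua').
    by rewrite -/(conn s1 w u) /conn conn_sym.
  case: ifP => [u'v'|/negbT nu'v'].
    have u'w : conn s1 u' w.
      by case/orP: uvw' => // v'w; exact: connect_trans v'w.
    by rewrite (b_const _ _ u'w) /=; lia.
  case/orP: uvw' => aw; rewrite (b_const _ _ aw).
    by have := near _ _ aw nu'v'; rewrite /=; lia.
  rewrite /conn conn_sym in nu'v'.
  by have := near _ _ aw nu'v'; rewrite /=; lia.
pose F1 w := (b w - n * conn s1 u w)%N.
have F1_const : comp_const s1 F1.
  move=> w w' ww'; rewrite /F1 (b_const _ _ ww'); congr (_ - n * nat_of_bool _)%N.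
  by rewrite /conn ![connect _ u _](conn_sym s1) (same_connect (@conn_sym G s1) ww').
have F1_le w : (F1 w <= n)%N by have := b_near w; rewrite /F1; lia.
have s1i : #|s1| = i.+1 by rewrite cardsU1 es card_state_set.
have [y ys yF] := exists_state s1i F1_const F1_le.
have y_sum w : (factor_degree y w + n * conn s1 u w = b w)%N.
  by rewrite yF subnK.
exists y; rewrite edge_mapE ?es -?/s -/s1 ?ys ?eqxx /=.
  by apply/forallP => w; apply/eqP/y_sum.
rewrite in_setU1 negb_or eq_sym ef fs zt eqxx /=; apply/forallP => w.
have := eqP (zP w); rewrite -(comp_sum_trans _ _ _ s1t) -/b.
have -> : comp_sum s1 t b w =
    (comp_sum s1 t (factor_degree y) w + n * conn t u w)%N.
  rewrite -(comp_sum_ind _ _ _ s1t) /comp_sum -big_split /=.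
  by apply: eq_bigr => r _; rewrite y_sum.
by rewrite -/t -/u'; lia.
Qed.

(** The coefficient of [z] in the composite of the per-edge maps of [e] and [f]
    applied to [x], without signs. *)
Definition edge_steps i (e f : edge G) (x : state n G i) (z : state n G i.+2) : nat :=
  \sum_(y : state n G i.+1) (edge_map e x y && edge_map f y z).

Lemma edge_stepsC i e f (x : state n G i) z : edge_steps e f x z = edge_steps f e x z.
Proof.
have stepsE a b : edge_steps a b x z =
    [exists y : state n G i.+1, edge_map a x y && edge_map b y z] :> nat.
  rewrite /edge_steps; case: (altP existsP) => [[y /andP[xy yz]]|].
    rewrite (bigD1 y) //= xy yz big1 // => y' ny.
    apply/eqP; rewrite eqb0; apply: contra ny => /andP[xy' _].
    by rewrite (edge_map_inj xy' xy).
  rewrite negb_exists => /forallP none; rewrite big1 // => y _.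
  by rewrite (negPf (none y)).
have existsE a b : [exists y : state n G i.+1, edge_map a x y && edge_map b y z] <->
    (exists2 y : state n G i.+1, edge_map a x y & edge_map b y z).
  by split=> [/existsP[y /andP[]]|[y xy yz]]; [exists y|apply/existsP; exists y; rewrite xy].
have flip a b : (exists2 y : state n G i.+1, edge_map a x y & edge_map b y z) ->
    exists2 y : state n G i.+1, edge_map b x y & edge_map a y z.
  move=> /edge_map2P/and5P[as_ bs ab zt /forallP zP]; apply/edge_map2P.
  rewrite as_ bs eq_sym ab setUCA zt /=; apply/forallP => w.
  by rewrite addnAC; exact: zP.
by rewrite !stepsE; congr nat_of_bool; apply/idP/idP => /existsE/flip/existsE.
Qed.

Lemma edge_steps_support i e f (x : state n G i) z :
  edge_steps e f x z != 0%N ->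
  [/\ e \notin state_set x, f \notin state_set x & e != f].
Proof.
rewrite sum_nat_eq0 negb_forall => /existsP[y]; rewrite eqb0 negbK => /andP[xy yz].
suff /edge_map2P/and5P[] : exists2 y : state n G i.+1, edge_map e x y & edge_map f y z by [].
by exists y.
Qed.

Lemma edge_sign_setU1 (s : {set edge G}) e f :
  e \notin s ->
  edge_sign o (e |: s) f = (-1) ^+ (index e o < index f o)%N * edge_sign o s f.
Proof.
move=> es; rewrite /edge_sign -exprD; congr (_ ^+ _).
set A := [set g in s | _].
have -> : [set g in e |: s | (index g o < index f o)%N] =
    if (index e o < index f o)%N then e |: A else A.
  apply/setP => g; rewrite !inE; case: ifP => ef; rewrite ?inE.
    by case: eqP => [->|//]; rewrite ef.
  by case: eqP => [->|//]; rewrite ef (negPf es).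
by case: ifP => ef; rewrite ?cardsU1 ?inE ?(negPf es).
Qed.

(** Of the two edges, the one which comes first in the ordering changes the sign of
    the other when it is added first. *)
Lemma edge_sign_anticomm (s : {set edge G}) e f :
  e \notin s -> f \notin s -> e != f ->
  edge_sign o (e |: s) f * edge_sign o s e =
  - (edge_sign o (f |: s) e * edge_sign o s f).
Proof.
move=> es fs ef; rewrite !edge_sign_setU1 //.
have mem_o g : g \in o by rewrite (perm_mem o_ordering) mem_enum.
have : index e o != index f o.
  by apply: contra ef => /eqP E; rewrite -(nth_index e (mem_o e)) E nth_index.
by case: ltngtP => //= _ _; rewrite ?expr1 ?expr0; ring.
Qed.

Lemma differential_square0 i (c : {ffun state n G i -> int}) :
  differential o (differential o c) = 0.
Proof.
apply/ffunP => z; rewrite !ffunE.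
transitivity (\sum_x c x * \sum_e \sum_f (edge_steps e f x z)%:R *
  (edge_sign o (e |: state_set x) f * edge_sign o (state_set x) e)).
  transitivity (\sum_(y : state n G i.+1) \sum_(x : state n G i) \sum_e \sum_f
      c x * ((edge_map e x y && edge_map f y z)%:R *
        (edge_sign o (e |: state_set x) f * edge_sign o (state_set x) e))).
    apply: eq_bigr => y _; rewrite ffunE.
    under eq_bigr => f _ do rewrite mulr_sumr.
    rewrite exchange_big /=; apply: eq_bigr => x _.
    under eq_bigr => f _ do rewrite mulr_sumr.
    rewrite exchange_big big_mkcond /=; apply: eq_bigr => e _.
    case: ifP => [exy|nexy]; last by rewrite big1 // => f _; rewrite mul0r mulr0.
    rewrite big_mkcond /=; apply: eq_bigr => f _; case: ifP => _; last by rewrite mul0r mulr0.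
    have := exy; rewrite edge_mapE => /and3P[_ /eqP -> _].
    by rewrite /= mul1r mulrA mulrC.
  rewrite exchange_big; apply: eq_bigr => x _ /=; rewrite mulr_sumr exchange_big.
  apply: eq_bigr => e _ /=; rewrite mulr_sumr exchange_big; apply: eq_bigr => f _ /=.
  by rewrite -mulr_sumr -mulr_suml -natr_sum.
rewrite big1 // => x _; apply/eqP; rewrite mulf_eq0; apply/orP; right.
set T := \sum_e _; suff : T = - T by move=> TN; apply/eqP; lia.
rewrite {1}/T exchange_big /T -sumrN; apply: eq_bigr => e _.
rewrite -sumrN; apply: eq_bigr => f _ /=; rewrite -mulrN edge_stepsC.
have [->|/edge_steps_support[es fs ef]] := eqVneq (edge_steps e f x z) 0%N.
  by rewrite !mul0r.
by congr (_ * _); rewrite edge_sign_anticomm // eq_sym.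
Qed.

End SquareZero.

(** * Ranks of the homology groups *)

Section HomologyClasses.
Variables (C : graded_complex) (i : nat) (k : int).

Local Notation boundaries := (@is_coboundary C i k).
Local Notation cycles := (@is_cocycle C i k).

(** Chains which are not cocycles are sent to the class of [0]. *)
Definition homology_class (c : term C i) : homology_piece C i k :=
  \pi_(Quotient.quot boundaries)%qT (insubd (0 : cocycle C i k) c).

Lemma homology_classB c c' :
  c \in cycles -> c' \in cycles ->
  homology_class (c - c') = homology_class c - homology_class c'.
Proof.
move=> cP c'P; rewrite /homology_class.
rewrite -[RHS](raddfB (\pi_(Quotient.quot boundaries)%qT)); congr (\pi_(_)%qT _).
by apply: val_inj; rewrite raddfB /= !insubdK ?rpredB.
Qed.

Lemma homology_class_surj h : exists2 c, c \in cycles & homology_class c = h.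
Proof.
exists (val (repr (h : Quotient.quot boundaries))); first exact: valP.
by rewrite /homology_class valKd reprK.
Qed.

Lemma homology_class_eq0 c :
  c \in cycles -> homology_class c = 0 <-> coboundary_prop (C := C) k c.
Proof.
move=> cP; rewrite /homology_class -(raddf0 (\pi_(Quotient.quot boundaries)%qT)).
have : (insubd (0 : cocycle C i k) c - 0 \in boundaries) =
  (\pi_(Quotient.quot boundaries)%qT (insubd (0 : cocycle C i k) c) == \pi_(Quotient.quot boundaries)%qT 0).
  exact: Quotient.idealrBE.
rewrite subr0 unfold_in /= -[cocycle_val _]/(val _) insubdK // => E.
split=> [/eqP|h]; first by rewrite -E => /boolp.asboolP.
by apply/eqP; rewrite -E; apply/boolp.asboolP.
Qed.

End HomologyClasses.

Section GradedPieces.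
Variables (n : nat) (G : graph) (o : seq (edge G)).
Hypothesis o_ordering : edge_ordering o.
Local Notation Cx := (dichromatic_complex n o).

Definition states_of_degree i (k : int) := [pred x : state n G i | degree x == k].

Local Notation basis i k := #|states_of_degree i k|.

Definition coordinates i k (c : {ffun state n G i -> int}) : 'rV[int]_(basis i k) :=
  \row_a c (enum_val a).

Definition of_coordinates i k (u : 'rV[int]_(basis i k)) : {ffun state n G i -> int} :=
  [ffun x => \sum_a u 0 a *+ (enum_val a == x)].

Definition differential_mx i k : 'M[int]_(basis i k, basis i.+1 k) :=
  \matrix_(a, b) \sum_(e | edge_map e (enum_val a) (enum_val b))
    edge_sign o (state_set (enum_val a)) e.

Lemma of_coordinatesK i k : cancel (@of_coordinates i k) (@coordinates i k).
Proof.
move=> u; apply/rowP => a; rewrite !mxE ffunE (bigD1 a) //= eqxx big1 ?addr0 // => b.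
by rewrite (inj_eq enum_val_inj) => /negPf ->.
Qed.

Lemma homogeneousP i k (c : {ffun state n G i -> int}) :
  reflect (forall x, degree x != k -> c x = 0) (c \in homogeneous k).
Proof.
apply: (iffP forallP) => cP x; last by apply/implyP; apply: contraR => /cP ->.
by move=> /negPf xk; have := cP x; rewrite xk implybF negbK => /eqP.
Qed.

Lemma homogeneous_of_coordinates i k (u : 'rV[int]_(basis i k)) :
  of_coordinates u \in homogeneous k.
Proof.
apply/homogeneousP => x xk; rewrite ffunE big1 // => a _.
by case: eqP => // xE; have := enum_valP a; rewrite inE xE (negPf xk).
Qed.

Lemma coordinatesK i k (c : {ffun state n G i -> int}) :
  c \in homogeneous k -> of_coordinates (coordinates k c) = c.
Proof.
move=> /homogeneousP cP; apply/ffunP => x; rewrite ffunE.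
under eq_bigr => a _ do rewrite mxE.
rewrite -(big_enum_val (fun y => c y *+ (y == x))) big_mkcond /= (bigD1 x) //=.
rewrite eqxx inE big1 ?addr0 => [|y /negPf ->]; last by rewrite mulr0n if_same.
by case: eqP => // /eqP/cP ->.
Qed.

Lemma of_coordinatesB i k (u v : 'rV[int]_(basis i k)) :
  of_coordinates (u - v) = of_coordinates u - of_coordinates v.
Proof.
apply/ffunP => x; rewrite !ffunE -sumrB; apply: eq_bigr => a _.
by rewrite !mxE mulrnBl.
Qed.

Lemma of_coordinates0 i k : of_coordinates (0 : 'rV[int]_(basis i k)) = 0.
Proof. by rewrite -[X in of_coordinates X](subrr 0) of_coordinatesB subrr. Qed.

Lemma homogeneous_differential i k (c : {ffun state n G i -> int}) :
  c \in homogeneous k -> differential o c \in homogeneous k.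
Proof.
move=> /homogeneousP cP; apply/homogeneousP => y yk.
rewrite ffunE big1 // => x _; rewrite big1 // => e xy.
by rewrite cP ?mulr0 // (edge_map_degree xy).
Qed.

Lemma coordinates_differential i k (c : {ffun state n G i -> int}) :
  coordinates k (differential o c) = coordinates k c *m differential_mx i k.
Proof.
apply/rowP => b; rewrite !mxE ffunE (bigID (mem (states_of_degree i k))) /=.
rewrite [X in _ + X]big1 ?addr0 => [|x /negP xk]; last first.
  rewrite big1 // => e xy; case: xk.
  by rewrite inE (edge_map_degree xy); exact: (enum_valP b).
rewrite big_enum_val; apply: eq_bigr => a _; rewrite !mxE mulr_sumr.
by apply: eq_bigr => e _; rewrite mulrC.
Qed.

Lemma coordinates0 i k (c : {ffun state n G i -> int}) :
  c \in homogeneous k -> coordinates k c = 0 -> c = 0.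
Proof.
by move=> /coordinatesK cE c0; rewrite -cE c0 of_coordinates0.
Qed.

Definition mx_rank i k : nat :=
  \rank (map_mx intr (differential_mx i k) : 'M[rat]_(_, _)).

(** The rank of the differential arriving in position [i]; none arrives in
    position [0]. *)
Definition mx_rank_to i k : nat := if i is j.+1 then mx_rank j k else 0.

(** Rank-nullity for the component of degree [k]. In position [0] the incoming
    differential is an empty matrix. *)
Lemma rank_homology i k :
  (rank (homology Cx i k) + mx_rank_to i k + mx_rank_to i.+1 k = basis i k)%N.
Proof.
have cycleE (u : 'rV[int]_(basis i k)) :
    (of_coordinates u \in is_cocycle (C := Cx) (i := i) k) <-> u *m differential_mx i k = 0.
  rewrite inE homogeneous_of_coordinates /=.
  have -> : u *m differential_mx i k = coordinates k (differential o (of_coordinates u)).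
    by rewrite coordinates_differential of_coordinatesK.
  split=> [/eqP ->|/coordinates0 d0]; first by apply/rowP => b; rewrite !mxE ffunE.
  by apply/eqP/d0; apply/homogeneous_differential/homogeneous_of_coordinates.
pose cl (u : 'rV[int]_(basis i k)) : homology_piece Cx i k :=
  homology_class k (of_coordinates u : term Cx i).
have clB u v : u *m differential_mx i k = 0 -> v *m differential_mx i k = 0 ->
    cl (u - v) = cl u - cl v.
  move=> /cycleE u0 /cycleE v0; rewrite /cl of_coordinatesB.
  exact: homology_classB.
have cl_surj h : exists2 u, u *m differential_mx i k = 0 & cl u = h.
  have [c cP ch] := homology_class_surj h.
  have cE : of_coordinates (coordinates k c) = c.
    by apply: coordinatesK; case/andP: cP.
  exists (coordinates k c); last by rewrite /cl cE.
  by apply/cycleE; rewrite cE.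
have cl0 u : u *m differential_mx i k = 0 ->
    cl u = 0 <-> coboundary_prop (C := Cx) k (of_coordinates u).
  by move=> /cycleE; exact: homology_class_eq0.
case: i @cl cycleE clB cl_surj cl0 => [|j] cl _ clB cl_surj cl0.
  pose D0 : 'M[int]_(0, basis 0%N k) := 0.
  have := rank_subquotient (mul0mx _ _ : D0 *m _ = 0) clB cl_surj.
  rewrite /= [map_mx _ D0]map_mx0 mxrank0; apply=> u u0.
  rewrite cl0 //=; split=> [c0|[w ->]].
    by exists 0; rewrite mulmx0 -[u]of_coordinatesK c0; apply/rowP => b; rewrite !mxE ffunE.
  by rewrite mulmx0; exact: of_coordinates0.
apply: (rank_subquotient (D1 := differential_mx j k) _ clB cl_surj) => [|u u0].
  apply/row_matrixP => a; rewrite row_mul row0 -[row a _]of_coordinatesK.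
  rewrite -coordinates_differential rowE -[delta_mx _ _]of_coordinatesK.
  rewrite -!coordinates_differential coordinatesK; last first.
    exact/homogeneous_differential/homogeneous_of_coordinates.
  rewrite differential_square0 //.
  by apply/rowP => b; rewrite !mxE ffunE.
rewrite cl0 //=; split=> [[c ck dc]|[w ->]].
  by exists (coordinates k c); rewrite -coordinates_differential -[u]of_coordinatesK -dc.
exists (of_coordinates w); first exact: homogeneous_of_coordinates.
rewrite -{2}[w]of_coordinatesK -coordinates_differential coordinatesK //.
exact/homogeneous_differential/homogeneous_of_coordinates.
Qed.

Lemma state_edge_bound i : (#|edge G| < i)%N -> state n G i -> False.
Proof. by move=> + x; rewrite -(card_state_set x) ltnNge max_card. Qed.

Lemma mx_rank_to0 k : mx_rank_to #|edge G|.+1 k = 0%N.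
Proof.
have := leq_trans (rank_leq_col _) (leqnn _) : (mx_rank #|edge G| k <= _)%N.
rewrite [X in (_ <= X)%N]eq_card0 ?leqn0 => [/eqP //|x].
by case: (state_edge_bound (ltnSn _) x).
Qed.

End GradedPieces.

(** * The graded Euler characteristic *)

Lemma alternating_sum_telescope (R : pzRingType) (a : nat -> R) m :
  \sum_(i < m.+1) (-1) ^+ i * (a i + a i.+1) = a 0%N + (-1) ^+ m * a m.+1.
Proof.
elim: m => [|m IH]; first by rewrite big_ord1 expr0 !mul1r.
by rewrite big_ord_recr /= IH exprS mulN1r !mulNr mulrDr opprD -addrA addNKr.
Qed.

Section EulerCharacteristic.
Variables (n : nat) (G : graph) (o : seq (edge G)).
Hypothesis o_ordering : edge_ordering o.
Local Notation Cx := (dichromatic_complex n o).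
Local Notation q := (FracField.tofrac ('X : {poly int})).

Definition ndegree i (x : state n G i) : nat :=
  \sum_(v in roots (adj (state_set x))) factor_degree x v + n * i.

Definition degree_bound : nat := (n * #|vertex G| + n * #|edge G|).+1.

Lemma ndegree_lt i (x : state n G i) : (ndegree x < degree_bound)%N.
Proof.
rewrite ltnS leq_add //.
  apply: leq_trans (_ : \sum_(v in roots (adj (state_set x))) n <= _)%N.
    by apply: leq_sum => v _; exact: factor_degree_le.
  by rewrite sum_nat_const mulnC leq_mul2l max_card orbT.
by rewrite leq_mul2l -(card_state_set x) max_card orbT.
Qed.

Lemma sum_states_by_degree (R : pzSemiRingType) (f : nat -> R) i :
  \sum_(d < degree_bound) #|states_of_degree n G i d|%:R * f d =
  \sum_(x : state n G i) f (ndegree x).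
Proof.
rewrite (partition_big (fun x => Ordinal (ndegree_lt x)) predT) //=.
apply: eq_bigr => d _; rewrite mulr_natl -sumr_const.
apply: congr_big => // [x|x].
  by rewrite inE degreeE -val_eqE /= eqz_nat.
by rewrite inE degreeE => /eqP[<-].
Qed.

Lemma qdim_homology i :
  qdim (homology Cx i) =
  \sum_(d < degree_bound) (rank (homology Cx i d))%:R * q ^+ d.
Proof.
rewrite /qdim (fsbigop.fsbigE [seq Posz d | d <- iota 0 degree_bound]) //.
- rewrite big_map -[X in iota 0 X]subn0 -/(index_iota 0 _) big_mkord.
  apply: eq_big => [d|d _]; last by [].
  by rewrite classical_sets.in_setT.
- by rewrite map_inj_uniq ?iota_uniq // => a b [].
move=> k _ kB; have := rank_homology n o_ordering i k.
rewrite (_ : #|_| = 0%N); last first.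
  apply: eq_card0 => x; rewrite !inE; apply: contraNF kB => /eqP <-.
  by rewrite degreeE map_f // mem_iota ndegree_lt.
by case: (rank _) => [_|//]; rewrite mul0r.
Qed.

(** By [rank_homology], the ranks of the differentials cancel in the alternating
    sum, and what is left counts the monomials in each degree. *)
Lemma euler_char_states :
  graded_euler_char #|edge G| (homology Cx) =
  \sum_(i < #|edge G|.+1) (-1) ^+ i * \sum_(x : state n G i) q ^+ ndegree x.
Proof.
transitivity (\sum_(i < #|edge G|.+1) (-1) ^+ i *
    \sum_(d < degree_bound) #|states_of_degree n G i d|%:R * q ^+ d); last first.
  by apply: eq_bigr => i _; rewrite (sum_states_by_degree (fun d => q ^+ d)).
rewrite /graded_euler_char.
pose r i := \sum_(d < degree_bound) (mx_rank_to n o i d)%:R * q ^+ d.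
under [RHS]eq_bigr => i _.
  rewrite (_ : \sum_(d < _) _ = qdim (homology Cx i) + (r i + r i.+1)); last first.
    rewrite qdim_homology -!big_split; apply: eq_bigr => d _ /=.
    by rewrite -!mulrDl -!natrD addnA rank_homology.
  rewrite mulrDr; over.
rewrite big_split /= alternating_sum_telescope.
have -> : r 0%N = 0 by rewrite /r big1 // => d _; rewrite mul0r.
have -> : r #|edge G|.+1 = 0 by rewrite /r big1 // => d _; rewrite mx_rank_to0 mul0r.
by rewrite mulr0 !addr0.
Qed.

(** A function constant on components is a free choice of one exponent for each
    component, so the generating function of the degrees is a product. *)
Lemma sum_comp_const (s : {set edge G}) :
  \sum_(a : {ffun vertex G -> 'I_n.+1} |
         [forall u, forall v, conn s u v ==> (a u == a v)])
     ('X : {poly int}) ^+ (\sum_(r in roots (adj s)) (n - a r))%N =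
  (\sum_(j < n.+1) 'X^j) ^+ ncomp s.
Proof.
set R := roots (adj s).
have -> : ncomp s = #|R| by apply: eq_card => v; rewrite !inE andbT.
(* The exponent [a] has degree [n - a], whence the reversal of the sum. *)
rewrite (reindex_inj rev_ord_inj) /= -prodr_const.
rewrite (big_distr_big ord0 (mem R) predT (fun _ j => 'X^(rev_ord j))).
(* Expanding the product gives functions on the representatives, extended to the
   other vertices by the default value [ord0]. *)
rewrite (reindex_onto (fun f : {ffun vertex G -> 'I_n.+1} => [ffun v => f (fingraph.root (adj s) v)])
  (fun a => [ffun v => if v \in R then a v else ord0])) /=; last first.
  move=> a /forallP aP; apply/ffunP => v; rewrite !ffunE in_roots rootK eqxx.
  have /forallP/(_ v)/implyP := aP (fingraph.root (adj s) v).
  by rewrite /conn conn_sym connect_root => /(_ isT)/eqP.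
apply: eq_big => [f|f _].
  apply/andP/pffun_onP => [[_ /eqP fE]|[/subsetP fsupp _]].
    split=> //; apply/subsetP => v; rewrite -fE inE ffunE.
    by case: ifP => //; rewrite eqxx.
  split.
    apply/forallP => u; apply/forallP => v; apply/implyP.
    by rewrite !ffunE -rootE => /eqP ->.
  apply/eqP/ffunP => v; rewrite !ffunE; case: ifP => [/eqP ->//|vR].
  by apply/esym/eqP; apply: contraFT vR; exact: fsupp.
rewrite -prodrXr; apply: eq_bigr => v /eqP vR; rewrite ffunE vR.
by rewrite /= subSS.
Qed.

Lemma dichromatic_specE :
  dichromatic_spec n G =
  \sum_(s : {set edge G}) (-1) ^+ #|s| * 'X^(n * #|s|) * (\sum_(j < n.+1) 'X^j) ^+ ncomp s.
Proof.
pose subst : {rmorphism {poly {poly int}} -> {poly {poly int}}} :=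
  map_poly (comp_poly 'X^n).
rewrite /dichromatic_spec /dichromatic -[map_poly _]/(subst : _ -> _) rmorph_sum.
rewrite horner_sum; apply: eq_bigr => s _.
rewrite !rmorphM !rmorphXn rmorphN1 /= map_polyX map_polyC /= comp_polyX.
by rewrite -polyC1 -polyCN -!polyC_exp !hornerE exprM.
Qed.

Lemma sum_states (R : nmodType) i (F : {set edge G} * {ffun vertex G -> 'I_n.+1} -> R) :
  \sum_(x : state n G i) F (val x) = \sum_(p | @is_state n G i p) F p.
Proof.
rewrite [RHS](reindex_omap (val : state n G i -> _) insub) /= => [|p pP]; last by rewrite insubT.
by apply: eq_bigl => -[p pP]; rewrite /= insubT pP eqxx.
Qed.

Lemma euler_char_dichromatic :
  graded_euler_char #|edge G| (homology Cx) = FracField.tofrac (dichromatic_spec n G).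
Proof.
rewrite euler_char_states dichromatic_specE.
pose T := ({set edge G} * {ffun vertex G -> 'I_n.+1})%type.
pose term (p : T) : {poly int} :=
  'X^(\sum_(r in roots (adj p.1)) (n - p.2 r) + n * #|p.1|)%N.
transitivity (FracField.tofrac (\sum_(i < #|edge G|.+1)
    (-1) ^+ i * \sum_(p | @is_state n G i p) term p)).
  rewrite rmorph_sum; apply: eq_bigr => i _ /=.
  rewrite rmorphM rmorphXn rmorphN1 rmorph_sum -sum_states.
  congr (_ * _); apply: eq_bigr => x _ /=.
  rewrite /term /= rmorphXn /ndegree.
  by rewrite (card_state_set x : #|(val x).1| = i).
congr FracField.tofrac.
transitivity (\sum_(p : T | @is_state n G #|p.1| p) (-1) ^+ #|p.1| * term p).
  rewrite (partition_big (fun p : T => inord #|p.1| : 'I_#|edge G|.+1) predT) //=.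
  apply: eq_bigr => i _; rewrite mulr_sumr; apply: eq_big => [p|p /andP[/eqP <- _] //].
  have p_lt : (#|p.1| < #|edge G|.+1)%N by rewrite ltnS max_card.
  by rewrite /is_state eqxx andbC -val_eqE /= inordK.
rewrite (eq_bigl (fun p : T => true && [forall u, forall v, conn p.1 u v ==> (p.2 u == p.2 v)])); last first.
  by move=> p; rewrite /is_state eqxx.
rewrite -(pair_big_dep predT (fun s (a : {ffun vertex G -> 'I_n.+1}) => [forall u, forall v, conn s u v ==> (a u == a v)])
  (fun s a => (-1) ^+ #|s| * term (s, a))) /=.
apply: eq_bigr => s _; rewrite -sum_comp_const mulr_sumr; apply: eq_bigr => a _.
by rewrite /term /= exprD mulrAC mulrA.
Qed.

End EulerCharacteristic.

(** * Invariance *)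

(** A chain map induces an additive map in homology: it is computed on chosen
    representatives, and the choice does not matter up to a coboundary. *)
Lemma homology_map (C C' : graded_complex) (f : forall i, {additive term C i -> term C' i}) k :
  (forall i c, c \in piece C i k -> f i c \in piece C' i k) ->
  (forall i c, f i.+1 (cdiff C i c) = cdiff C' i (f i c)) ->
  forall i, exists F : {additive homology C i k -> homology C' i k},
    forall c, c \in is_cocycle (C := C) (i := i) k ->
      F (homology_class k c) = homology_class k (f i c).
Proof.
move=> fk fd i.
have f_cycle c : c \in is_cocycle (C := C) (i := i) k -> f i c \in is_cocycle (C := C') (i := i) k.
  by rewrite !inE => /andP[/fk -> /eqP dc] /=; rewrite -fd dc raddf0.
have f_bound c : coboundary_prop (C := C) k c -> coboundary_prop (C := C') k (f i c).
  case: i c f_cycle => [|j] c _ /=; first by move=> ->; rewrite raddf0.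
  by move=> [b bk <-]; exists (f j b); rewrite ?fk ?fd.
pose rep h := sval (boolp.cid2 (@homology_class_surj C i k h)).
have repP h : rep h \in is_cocycle (C := C) (i := i) k /\ homology_class k (rep h) = h.
  by rewrite /rep; case: boolp.cid2.
pose F0 (h : homology C i k) : homology C' i k := homology_class k (f i (rep h)).
have F0E c : c \in is_cocycle (C := C) (i := i) k ->
    F0 (homology_class k c) = homology_class k (f i c).
  move=> cP; have [rP rE] := repP (homology_class k c); apply/eqP.
  rewrite -subr_eq0 -homology_classB ?f_cycle // -raddfB; apply/eqP.
  apply/homology_class_eq0; first by rewrite f_cycle ?rpredB.
  apply/f_bound/homology_class_eq0; first by rewrite rpredB.
  by rewrite homology_classB // rE subrr.
have F0B : zmod_morphism F0.
  move=> h h'; have [[rP rE] [r'P r'E]] := (repP h, repP h').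
  rewrite -[in LHS]rE -[in LHS]r'E -homology_classB // F0E ?rpredB //.
  by rewrite raddfB homology_classB ?f_cycle.
pose F : {additive homology C i k -> homology C' i k} :=
  HB.pack F0 (GRing.isZmodMorphism.Build _ _ F0 F0B).
by exists F.
Qed.

Lemma homology_iso (C C' : graded_complex) (f : forall i, {additive term C i -> term C' i})
    (g : forall i, {additive term C' i -> term C i}) :
  (forall i, cancel (f i) (g i)) -> (forall i, cancel (g i) (f i)) ->
  (forall i k c, c \in piece C i k -> f i c \in piece C' i k) ->
  (forall i k c, c \in piece C' i k -> g i c \in piece C i k) ->
  (forall i c, f i.+1 (cdiff C i c) = cdiff C' i (f i c)) ->
  forall i, gmodule_iso (homology C i) (homology C' i).
Proof.
move=> fK gK fk gk fd i k.
have gd j c : g j.+1 (cdiff C' j c) = cdiff C j (g j c).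
  by rewrite -{1}[c]gK -fd fK.
have [F FE] := homology_map (fun i => fk i k) fd i.
have [H HE] := homology_map (fun i => gk i k) gd i.
have f_cycle c : c \in is_cocycle (C := C) (i := i) k -> f i c \in is_cocycle (C := C') (i := i) k.
  by rewrite !inE => /andP[/fk -> /eqP dc] /=; rewrite -fd dc raddf0.
have g_cycle c : c \in is_cocycle (C := C') (i := i) k -> g i c \in is_cocycle (C := C) (i := i) k.
  by rewrite !inE => /andP[/gk -> /eqP dc] /=; rewrite -gd dc raddf0.
exists F; exists H => h; have [c cP <-] := homology_class_surj h.
  by rewrite FE // HE ?f_cycle // fK.
by rewrite HE // FE ?g_cycle // gK.
Qed.

Section Transport.
Variables (G G' : graph).
Variables (phi : vertex G -> vertex G') (phi' : vertex G' -> vertex G).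
Variables (psi : edge G -> edge G') (psi' : edge G' -> edge G).
Hypotheses (phiK : cancel phi phi') (psi'K : cancel psi' psi).
Hypothesis ends_psi : forall e, let: (u, v) := ends e in
  ends (psi e) = (phi u, phi v) \/ ends (psi e) = (phi v, phi u).

Lemma ends_psi_inv e : let: (u, v) := ends e in
  ends (psi' e) = (phi' u, phi' v) \/ ends (psi' e) = (phi' v, phi' u).
Proof.
have := ends_psi (psi' e); rewrite psi'K; case: (ends (psi' e)) => u v [] ->.
  by left; rewrite !phiK.
by right; rewrite !phiK.
Qed.

Lemma conn_transport (s : {set edge G}) u v :
  conn s u v -> conn (psi @: s) (phi u) (phi v).
Proof.
move=> /connectP[p]; elim: p u => [|w p IH] u /=; first by move=> _ ->; exact: connect0.
move=> /andP[/adjP[e es eE] /IH{}IH /IH]; apply: connect_trans.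
apply/connect1/adjP; exists (psi e); first exact: imset_f.
by have := ends_psi e; case: eE => -> [] ->; auto.
Qed.

End Transport.

Section StateTransport.
Variables (n : nat) (G G' : graph).
Variables (phi : vertex G -> vertex G') (phi' : vertex G' -> vertex G).
Variables (psi : edge G -> edge G') (psi' : edge G' -> edge G).
Hypotheses (phiK : cancel phi phi') (phi'K : cancel phi' phi).
Hypotheses (psiK : cancel psi psi') (psi'K : cancel psi' psi).
Hypothesis ends_psi : forall e, let: (u, v) := ends e in
  ends (psi e) = (phi u, phi v) \/ ends (psi e) = (phi v, phi u).

Lemma psiSK (s : {set edge G}) : psi' @: (psi @: s) = s.
Proof. by rewrite -imset_comp (eq_imset _ psiK) imset_id. Qed.

Lemma connE (s : {set edge G}) u v : conn (psi @: s) (phi u) (phi v) = conn s u v.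
Proof.
apply/idP/idP; last exact: conn_transport.
by move=> /(conn_transport (ends_psi_inv phiK psi'K ends_psi)); rewrite psiSK !phiK.
Qed.

Fact transport_subproof i (x : state n G i) :
  is_state i (psi @: (val x).1, [ffun v => (val x).2 (phi' v)]).
Proof.
rewrite /is_state /= card_imset; last exact: can_inj psiK.
case/andP: (valP x) => -> /forallP xP /=; apply/forallP => u; apply/forallP => v.
rewrite -{1}[u]phi'K -{1}[v]phi'K connE !ffunE.
by have /forallP := xP (phi' u).
Qed.

Definition transport i (x : state n G i) : state n G' i :=
  exist (fun p => is_state i p) _ (transport_subproof x).

Lemma state_set_transport i (x : state n G i) : state_set (transport x) = psi @: state_set x.
Proof. by []. Qed.

Lemma exponent_transport i (x : state n G i) v : exponent (transport x) v = exponent x (phi' v).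
Proof. by rewrite /exponent /= ffunE. Qed.

(** An isomorphism need not preserve the chosen representatives of the components,
    but it induces a bijection between them. *)
Lemma degree_transport i (x : state n G i) : degree (transport x) = degree x.
Proof.
rewrite !degreeE; congr (Posz (_ + _)).
have F v : factor_degree (transport x) v = factor_degree x (phi' v).
  by rewrite /factor_degree exponent_transport.
set s := state_set x; rewrite state_set_transport -/s.
rewrite (reindex_onto (fun r => fingraph.root (adj (psi @: s)) (phi r))
          (fun r => fingraph.root (adj s) (phi' r))) /=; last first.
  move=> r /eqP rr; rewrite -[RHS]rr -{2}[r]phi'K; apply/eqP.
  by rewrite rootE connE /conn conn_sym connect_root.
apply: eq_big => [r|r _].
  rewrite in_roots rootK eqxx /= -[RHS]/(fingraph.root _ r == r).
  have -> : fingraph.root (adj s) (phi' (fingraph.root (adj (psi @: s)) (phi r))) =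
            fingraph.root (adj s) r; last by [].
  apply/eqP; rewrite rootE -connE phi'K /conn conn_sym; exact: connect_root.
rewrite F; apply: factor_degree_const; rewrite -connE phi'K.
by rewrite /conn conn_sym; exact: connect_root.
Qed.

(** When [psi e] has its ends in the opposite order, the roles of [u] and [v] are
    exchanged; the coefficient does not change, because the exponents at [u] and [v]
    agree in [y], and also in [x] if [u] and [v] are already connected. *)
Lemma edge_map_transport i e (x : state n G i) (y : state n G i.+1) :
  edge_map (psi e) (transport x) (transport y) = edge_map e x y.
Proof.
have psi_inj := can_inj psiK.
rewrite /edge_map; have := ends_psi e; case E: (ends e) => [u v] ends_e.
rewrite !state_set_transport (mem_imset _ _ psi_inj).
rewrite -imsetU1 (inj_eq (imset_inj psi_inj)).
set s := state_set x; case: (boolP (e \in s)) => es; first by case: ends_e => ->.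
case: (state_set y =P e |: s) => ys; last by case: ends_e => ->.
have symm a b : conn s a b = conn s b a by exact: conn_sym.
have yuv : exponent y u = exponent y v.
  apply: exponent_const; rewrite ys (conn_setU1_end _ _ E) orbC.
  by rewrite (_ : conn s v v) //; exact: connect0.
have xuv : conn s u v -> exponent x u = exponent x v by exact: exponent_const.
case: ends_e => -> /=; congr (_ && _).
- apply/forallP/forallP => h w.
    by have := h (phi w); rewrite !connE !exponent_transport !phiK.
  by rewrite -[w]phi'K !connE !exponent_transport phiK; exact: h.
- by rewrite connE !exponent_transport !phiK.
- apply/forallP/forallP => h w.
    by have := h (phi w); rewrite !connE !exponent_transport !phiK andbC.
  by rewrite -[w]phi'K !connE !exponent_transport phiK andbC; exact: h.
rewrite connE !exponent_transport !phiK symm yuv; case: ifP => [/xuv -> //|_].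
by rewrite addnC.
Qed.

End StateTransport.

(** The parity of the number of inversions: pairs of edges of [s] which are in
    opposite orders for [o] and, through [psi], for [o']. *)
Definition reordering_sign (G G' : graph) (o : seq (edge G)) (o' : seq (edge G'))
    (psi : edge G -> edge G') (s : {set edge G}) : int :=
  \prod_(f in s) \prod_(g in s)
    (-1) ^+ ((index f o < index g o) && (index (psi g) o' < index (psi f) o'))%N.

Lemma edge_signE (G : graph) (o : seq (edge G)) s e :
  edge_sign o s e = \prod_(f in s) (-1) ^+ (index f o < index e o)%N.
Proof.
rewrite /edge_sign -sum1_card big_mkcond /= expr_sum [RHS]big_mkcond /=.
by apply: eq_bigr => f _; rewrite inE; case: (f \in s) => //=; case: ltnP.
Qed.

Lemma reordering_sign_sq G G' (o : seq (edge G)) (o' : seq (edge G')) psi s :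
  reordering_sign o o' psi s * reordering_sign o o' psi s = 1.
Proof.
rewrite -big_split big1 //= => f _; rewrite -big_split big1 //= => g _.
by rewrite -expr2 -exprM mulnC exprM sqrrN !expr1n.
Qed.

(** The new inversions are the [f] in [s] which lie on different sides of [e] in
    the two orderings; their number has the parity of the sum of the numbers of
    [f] before [e] in each of the orderings. *)
Lemma reordering_sign_setU1 G G' (o : seq (edge G)) (o' : seq (edge G'))
    (psi : edge G -> edge G') e (s : {set edge G}) :
  edge_ordering o -> edge_ordering o' -> injective psi -> e \notin s ->
  reordering_sign o o' psi (e |: s) * edge_sign o s e =
  edge_sign o' (psi @: s) (psi e) * reordering_sign o o' psi s.
Proof.
move=> oP o'P psi_inj es.
have index_inj (H : graph) (l : seq (edge H)) f g :
    edge_ordering l -> f != g -> index f l != index g l.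
  move=> lP; have mem_l h : h \in l by rewrite (perm_mem lP) mem_enum.
  by apply: contra => /eqP E; rewrite -(nth_index f (mem_l f)) E nth_index.
rewrite !edge_signE /reordering_sign big_imset /=; last by move=> f g _ _ /psi_inj.
rewrite !big_setU1 //= ltnn mul1r.
under [X in _ * X * _]eq_bigr => f _ do rewrite big_setU1 //=.
rewrite big_split /= mulrA mulrAC; congr (_ * _).
rewrite -!big_split /=; apply: eq_bigr => f fs /=.
have fe : f != e by apply: contraNneq es => <-.
have := index_inj _ o _ _ oP fe; have := index_inj _ o' (psi f) (psi e) o'P.
rewrite (inj_eq psi_inj) => /(_ fe).
by case: (ltngtP (index f o)); case: (ltngtP (index (psi f) o')).
Qed.

Lemma graph_iso_homology n (G G' : graph) (o : seq (edge G)) (o' : seq (edge G')) :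
  edge_ordering o -> edge_ordering o' -> graph_iso G G' ->
  forall i, gmodule_iso (homology (dichromatic_complex n o) i)
                        (homology (dichromatic_complex n o') i).
Proof.
move=> oP o'P [phi [psi [[phi' phiK phi'K] [psi' psiK psi'K] ends_psi]]].
have ends_psi' := ends_psi_inv phiK psi'K ends_psi.
pose T i (x : state n G i) := transport phiK phi'K psiK psi'K ends_psi x.
pose T' i (x : state n G' i) := transport phi'K phiK psi'K psiK ends_psi' x.
have TK i : cancel (@T i) (@T' i).
  move=> x; apply: state_factor_degree_inj => [|v]; first exact: psiSK.
  by rewrite /factor_degree !exponent_transport phiK.
have T'K i : cancel (@T' i) (@T i).
  move=> x; apply: state_factor_degree_inj => [|v]; first exact: psiSK.
  by rewrite /factor_degree !exponent_transport phi'K.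
pose sgn i (x : state n G i) := reordering_sign o o' psi (state_set x).
pose f0 i (c : {ffun state n G i -> int}) : {ffun state n G' i -> int} :=
  [ffun x' => sgn i (T' i x') * c (T' i x')].
pose g0 i (c : {ffun state n G' i -> int}) : {ffun state n G i -> int} :=
  [ffun x => sgn i x * c (T i x)].
have f0B i : zmod_morphism (@f0 i).
  by move=> a b; apply/ffunP => x; rewrite !ffunE mulrBr.
have g0B i : zmod_morphism (@g0 i).
  by move=> a b; apply/ffunP => x; rewrite !ffunE mulrBr.
pose f i : {additive chain n G i -> chain n G' i} :=
  HB.pack (@f0 i) (GRing.isZmodMorphism.Build _ _ (@f0 i) (f0B i)).
pose g i : {additive chain n G' i -> chain n G i} :=
  HB.pack (@g0 i) (GRing.isZmodMorphism.Build _ _ (@g0 i) (g0B i)).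
apply: (@homology_iso (dichromatic_complex n o) (dichromatic_complex n o') f g).
- move=> i c; apply/ffunP => x; rewrite !ffunE TK mulrA.
  by rewrite reordering_sign_sq mul1r.
- move=> i c; apply/ffunP => x; rewrite !ffunE T'K mulrA.
  by rewrite reordering_sign_sq mul1r.
- move=> i k c /homogeneousP ck; apply/homogeneousP => x xk; rewrite ffunE ck ?mulr0 //.
  by rewrite degree_transport.
- move=> i k c /homogeneousP ck; apply/homogeneousP => x xk; rewrite ffunE ck ?mulr0 //.
  by rewrite degree_transport.
move=> i c; apply/ffunP => y'; rewrite -[y']T'K !ffunE TK; set y := T' _ y'.
rewrite (reindex (@T i)) /=; last by exists (@T' i) => x _; rewrite ?TK ?T'K.
rewrite mulr_sumr; apply: eq_bigr => x _; rewrite ffunE TK.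
rewrite [RHS](reindex psi) /=; last by exists psi' => e _; rewrite ?psiK ?psi'K.
rewrite mulr_sumr; apply: eq_big => [e|e xy]; first by rewrite edge_map_transport.
have := xy; rewrite edge_mapE => /and3P[es /eqP ys _].
rewrite !mulrA /sgn ys reordering_sign_setU1 //; exact: can_inj psiK.
Qed.

Theorem theorem7 (n : nat) (n_gt0 : (0 < n)%N) (G : graph) (o : seq (edge G))
    (ho : edge_ordering o) :
  (forall (G' : graph) (o' : seq (edge G')), edge_ordering o' ->
     graph_iso G G' ->
     forall i : nat, gmodule_iso (homology (dichromatic_complex n o) i)
                                 (homology (dichromatic_complex n o') i)) /\
  graded_euler_char #|edge G| (homology (dichromatic_complex n o)) =
    FracField.tofrac (dichromatic_spec n G).
Proof.
split; last exact: euler_char_dichromatic.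
by move=> G' o' o'P iso; exact: graph_iso_homology.
Qed.
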